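(* Let $m\ge 1$ and $n\ge 1$ be integers. (1) The $i$-th entry $h_i$ of the $h$-vector of $\Delta^m_{A_{n-1}}$ is equal to $$\frac{1}{i+1}\binom{n-1}{i}\binom{mn}{i},\qquad i=0,\ldots,n-1.$$ (2) The $i$-th entry $h_i$ of the $h$-vector of $\Delta^m_{B_n}$ is equal to $$\binom{n}{i}\binom{mn}{i},\qquad i=0,\ldots,n.$$
   Context: Two diagonals of a convex polygon cross if they meet in their relative interiors. Definition of $\Delta^m_{A_{n-1}}$. Let $P$ be a convex $(mn+2)$-gon. $\Delta^m_{A_{n-1}}$ is the abstract simplicial complex whose vertices are the diagonals of $P$ that dissect $P$ into an $(mj+2)$-gon and an $(m(n-j)+2)$-gon for some $1\le j\le n-1$, and whose faces are the sets of pairwise noncrossing diagonals of this type. It is pure of dimension $n-2$. Definition of $\Delta^m_{B_n}$. Let $P$ be a centrally symmetric convex polygon with $2mn+2$ vertices labeled in anticlockwise order $1,2,\ldots,mn+1,\overline{1},\overline{2},\ldots,\overline{mn+1}$ (with the convention $\overline{\overline{i}}=i$). A $B$-diagonal of $P$ is either (i) a diameter, i.e. a diagonal joining antipodal points $i$ and $\overline{i}$ for some $1\le i\le mn+1$, or (ii) a pair of noncrossing diagonals $ij,\ \overline{i}\,\overline{j}$ for two distinct $i,j\in\{1,\ldots,mn+1,\overline{1},\ldots,\overline{mn+1}\}$ that are nonconsecutive around the boundary of $P$. Two $B$-diagonals are noncrossing if no diagonal of one crosses a diagonal of the other. $\Delta^m_{B_n}$ is the abstract simplicial complex whose vertices are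 the $B$-diagonals that dissect $P$ into a pair of $(mj+2)$-gons and a centrally symmetric $(2m(n-j)+2)$-gon for some $1\le j\le n$ (for $j=n$ the central polygon degenerates to a 2-gon and the $B$-diagonal is a diameter), and whose faces are the sets of pairwise noncrossing $B$-diagonals of this type. It is pure of dimension $n-1$. $h$-vector. For a finite simplicial complex of dimension $d-1$ with $f_i$ faces of dimension $i$ (and $f_{-1}=1$), the $h$-vector $(h_0,h_1,\ldots,h_d)$ is defined by $\sum_{i=0}^d f_{i-1}(x-1)^{d-i}=\sum_{i=0}^d h_i x^{d-i}$. *)

(* Defs.v *)
From HB Require Import structures.
From mathcomp Require Import all_boot all_order all_algebra.
From mathcomp Require Import boolp reals.

Set Implicit Arguments.
Unset Strict Implicit.
Unset Printing Implicit Defensive.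

Import Order.TTheory GRing.Theory Num.Theory.
Local Open Scope ring_scope.

(** * Simplicial complexes and h-vectors

    A finite simplicial complex on [T] is given by its set of faces (including
    the empty face); a face of dimension [k - 1] is one of cardinality [k]. *)

Definition fcount (T : finType) (K : {set {set T}}) (k : nat) : nat :=
  #|[set F in K | #|F| == k]|.

(** The [d] such that [K] has dimension [d - 1]. *)
Definition cdim (T : finType) (K : {set {set T}}) : nat :=
  (\max_(F in K) #|F|)%N.

Definition hpoly (T : finType) (K : {set {set T}}) : {poly int} :=
  \sum_(i < (cdim K).+1) (fcount K i)%:R *: ('X - 1) ^+ (cdim K - i).

Definition hvector (T : finType) (K : {set {set T}}) : seq int :=
  mkseq (fun i => (hpoly K)`_(cdim K - i)) (cdim K).+1.

(** The defining identity
    [sum_i f_{i-1} (x-1)^{d-i} = sum_i h_i x^{d-i}]. *)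
Lemma hvectorP (T : finType) (K : {set {set T}}) :
  \sum_(i < (cdim K).+1) (fcount K i)%:R *: ('X - 1) ^+ (cdim K - i) =
  \sum_(i < (cdim K).+1) (hvector K)`_i *: 'X^(cdim K - i) :> {poly int}.
Proof.
rewrite -/(hpoly K); set d := cdim K.
have sz : (size (hpoly K) <= d.+1)%N.
  rewrite /hpoly -/d; apply: (leq_trans (size_sum _ _ _)).
  apply/bigmax_leqP => i _; apply: (leq_trans (size_scale_leq _ _)).
  by rewrite -polyC1 size_exp_XsubC ltnS leq_subr.
rewrite (reindex_inj rev_ord_inj) /=.
have -> : hpoly K = \poly_(i < d.+1) (hpoly K)`_i.
  apply/polyP => i; rewrite coef_poly; case: ltnP => // le_di.
  by rewrite nth_default // (leq_trans sz).
rewrite poly_def; apply: eq_bigr => i _.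
by rewrite subSS nth_mkseq ?ltnS ?leq_subr // subKn // -ltnS.
Qed.

(** The faces are the sets of elements of [V] that are pairwise not related by
    [cross]. *)
Definition noncrossing_complex (T : finType) (V : pred T) (cross : rel T) :
    {set {set T}} :=
  [set F : {set T} | [forall x in F, V x] &&
           [forall x in F, forall y in F, (x != y) ==> ~~ cross x y]].

(** * Convex polygons and their diagonals

    A polygon with [N.+2] vertices is given by the positions [p : 'I_N.+2 ->
    'rV[R]_2] of its vertices, in anticlockwise order. Indices are added
    cyclically, using the ring structure of ['I_N.+2]. *)

(** Twice the signed area of the triangle [abc]. *)
Definition orient (R : realType) (a b c : 'rV[R]_2) : R :=
  (b 0 0 - a 0 0) * (c 0 1 - a 0 1) - (b 0 1 - a 0 1) * (c 0 0 - a 0 0).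

(** Every vertex not on a side lies strictly to the left of that side; in
    particular no three vertices are collinear. *)
Definition convex_polygon (R : realType) (N : nat) (p : 'I_N.+2 -> 'rV[R]_2) :
    Prop :=
  forall i k : 'I_N.+2, k != i -> k != i + 1 ->
    0 < orient (p i) (p (i + 1)) (p k).

Definition nonconsecutive (N : nat) (i j : 'I_N.+2) : bool :=
  [&& i != j, j != i + 1 & i != j + 1].

(** A diagonal is the set of its two endpoints. *)
Definition is_diagonal (N : nat) (d : {set 'I_N.+2}) : bool :=
  [exists i, exists j, nonconsecutive i j && (d == [set i; j])].

(** [x] lies in the relative interior of the segment with endpoints [d]. *)
Definition in_relint (R : realType) (N : nat) (p : 'I_N.+2 -> 'rV[R]_2)
    (d : {set 'I_N.+2}) (x : 'rV[R]_2) : Prop :=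
  exists i j (t : R), [/\ d = [set i; j], 0 < t < 1 &
                          x = (1 - t) *: p i + t *: p j].

Definition cross (R : realType) (N : nat) (p : 'I_N.+2 -> 'rV[R]_2) :
    rel {set 'I_N.+2} :=
  fun d e => `[< exists x, in_relint p d x /\ in_relint p e x >].

(** The vertices met when going anticlockwise from [i] to [j], both included:
    the diagonal [ij] dissects the polygon into the polygons with vertex sets
    [arc i j] and [arc j i]. *)
Definition arc (N : nat) (i j : 'I_N.+2) : {set 'I_N.+2} :=
  [set v | (nat_of_ord (v - i)%R <= nat_of_ord (j - i)%R)%N].

(** * The complex of type A *)

Definition A_vertex (m n : nat) (d : {set 'I_(m * n).+2}) : bool :=
  is_diagonal d &&
  [exists a, exists b, exists k : 'I_n,
    [&& d == [set a; b], (1 <= k)%N,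
        #|arc a b| == (m * k + 2)%N & #|arc b a| == (m * (n - k) + 2)%N]].

Definition Delta_A (R : realType) (m n : nat)
    (p : 'I_(m * n).+2 -> 'rV[R]_2) : {set {set {set 'I_(m * n).+2}}} :=
  noncrossing_complex (@A_vertex m n) (cross p).

(** * The complex of type B

    The labels [1, ..., mn+1] are the indices [0, ..., mn], and the barred
    labels are the indices [mn+1, ..., 2mn+1]. *)

Definition bar (m n : nat) (i : 'I_(2 * m * n).+2) : 'I_(2 * m * n).+2 :=
  i + inord (m * n).+1.

Definition centrally_symmetric (R : realType) (m n : nat)
    (p : 'I_(2 * m * n).+2 -> 'rV[R]_2) : Prop :=
  exists c : 'rV[R]_2, forall i, p (bar i) - c = - (p i - c).

(** A B-diagonal is a set of one (a diameter) or two diagonals. In the second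
    case [j] differs from [bar i], since a diagonal crosses itself in the sense
    of [cross]. *)
Definition is_B_diagonal (R : realType) (m n : nat)
    (p : 'I_(2 * m * n).+2 -> 'rV[R]_2) (D : {set {set 'I_(2 * m * n).+2}}) :
    bool :=
  [exists i, D == [set [set i; bar i]]] ||
  [exists i, exists j,
    [&& nonconsecutive i j, ~~ cross p [set i; j] [set bar i; bar j] &
        D == [set [set i; j]; [set bar i; bar j]]]].

Definition B_cross (R : realType) (m n : nat)
    (p : 'I_(2 * m * n).+2 -> 'rV[R]_2) :
    rel {set {set 'I_(2 * m * n).+2}} :=
  fun D E => [exists d in D, exists e in E, cross p d e].

(** When the arcs [a, b] and [bar a, bar b] are cut off, the central polygon has
    the vertices of the arcs [b, bar a] and [bar b, a]. For a diameter,
    [b = bar a] and the central polygon is the 2-gon [{a, bar a}]. *)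
Definition B_vertex (R : realType) (m n : nat)
    (p : 'I_(2 * m * n).+2 -> 'rV[R]_2) (D : {set {set 'I_(2 * m * n).+2}}) :
    bool :=
  is_B_diagonal p D &&
  [exists a, exists b, exists k : 'I_n.+1,
    [&& D == [set [set a; b]; [set bar a; bar b]], (1 <= k)%N,
        #|arc a b| == (m * k + 2)%N, #|arc (bar a) (bar b)| == (m * k + 2)%N &
        #|arc b (bar a) :|: arc (bar b) a| == (2 * m * (n - k) + 2)%N]].

Definition Delta_B (R : realType) (m n : nat)
    (p : 'I_(2 * m * n).+2 -> 'rV[R]_2) :
    {set {set {set {set 'I_(2 * m * n).+2}}}} :=
  noncrossing_complex (B_vertex p) (B_cross p).

(* Main.v *)
Require Import Defs.
From HB Require Import structures.
From mathcomp Require Import all_boot all_order all_algebra.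
From mathcomp Require Import boolp reals.
From mathcomp Require Import zify ring lra.

Set Implicit Arguments.
Unset Strict Implicit.
Unset Printing Implicit Defensive.

Import Order.TTheory GRing.Theory Num.Theory.
Local Open Scope ring_scope.

(** The h-vector is determined by the face numbers, so the theorem amounts to
    counting dissections: the faces with [k] elements number
    ['C(n - 1, k) 'C(m n + k + 1, k) / (k + 1)] in type A ([fcount_Delta_A]) and
    ['C(n, k) 'C(m n + k, k)] in type B ([fcount_Delta_B]). Vandermonde's
    convolution shows that these numbers belong to the stated h-vectors
    ([h_to_f_A], [h_to_f_B], [hvector_fcount]).

    Geometry enters only once. In a convex polygon all triples of vertices are
    oriented alike ([convex_orient]), hence two distinct diagonals cross exactly
    when their endpoints interleave, whatever the vertex from which the vertices
    are numbered ([cross_interleaved]).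

    Both types reduce to one count: that of laminar families of [s] intervals of
    lengths 1 modulo [m], greater than 1, in an integer window [[x, y]], refined
    by the number [r] of points of [[x, y)] that are exposed, that is, strictly
    inside no interval of the family. If no interval starts at [x], the point
    [x] can be dropped. Otherwise the longest such interval can be removed; this
    increases [r] by a multiple of [m], and the removed interval is recovered
    from the increase. The resulting recursion ([nb_laminar_rec]) has a closed
    solution of ballot type ([nb_laminarE]).

    In type A, numbering the vertices from one end of a fixed side to the other
    makes faces into laminar families that omit the full interval, and adding
    the full interval makes [r] equal to 1.

    In type B, the polygon has [2 M] vertices with [M = m n + 1]. The faces
    compatible with a given diameter are the laminar families of a window of
    length [M], obtained by cutting the polygon along this diameter, and the
    number of diameters compatible with such a face is its number [r] of exposed
    points. Counting the pairs of a face and a compatible diameter in two ways,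
    [r] times the number of faces with [r] compatible diameters is [M] times a
    number of laminar families ([card_nb_diameters]). As every face is
    compatible with some diameter ([nb_diameters_gt0]), dividing by [r] and
    summing gives the face numbers. *)

(** * Noncrossing families under bijections *)

Lemma noncrossingP (T : finType) (V : pred T) (c : rel T) (F : {set T}) :
  reflect ((forall x, x \in F -> V x) /\
           (forall x y, x \in F -> y \in F -> x != y -> ~~ c x y))
          (F \in noncrossing_complex V c).
Proof.
rewrite inE; apply: (iffP andP) => -[h1 h2]; split; try exact/forall_inP.
  move=> x y xF yF.
  by move/forall_inP: h2 => /(_ x xF)/forall_inP/(_ y yF)/implyP.
apply/forall_inP => x xF; apply/forall_inP => y yF; apply/implyP; exact: h2.
Qed.

(** A noncrossing complex is determined by its vertices and their crossing
    relation, so a bijection of vertices that preserves crossing carries faces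
    to faces of the same size. [P] and [Q] allow a statistic of faces to be
    carried along. *)
Lemma card_noncrossing_iso (S T : finType) (VS : pred S) (VT : pred T)
    (cS : rel S) (cT : rel T) (phi : S -> T)
    (P : pred {set S}) (Q : pred {set T}) (k : nat) :
  (forall s, VS s -> VT (phi s)) ->
  (forall t, VT t -> exists2 s, VS s & phi s = t) ->
  (forall s s', VS s -> VS s' -> phi s = phi s' -> s = s') ->
  (forall s s', VS s -> VS s' -> s != s' -> cT (phi s) (phi s') = cS s s') ->
  (forall F, F \in noncrossing_complex VS cS -> Q (phi @: F) = P F) ->
  #|[set F in noncrossing_complex VS cS | (#|F| == k) && P F]| =
  #|[set G in noncrossing_complex VT cT | (#|G| == k) && Q G]|.
Proof.
move=> phiV onto inj cE PQ.
have injF F F' : F \in noncrossing_complex VS cS ->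
    F' \in noncrossing_complex VS cS -> phi @: F = phi @: F' -> F \subset F'.
  move=> /noncrossingP[FV _] /noncrossingP[FV' _] E; apply/subsetP => s sF.
  have /imsetP[s' s'F' ss'] : phi s \in phi @: F' by rewrite -E imset_f.
  by rewrite (inj _ _ (FV _ sF) (FV' _ s'F') ss').
rewrite -(@card_in_imset _ _ (fun F : {set S} => phi @: F)); last first.
  move=> F F'; rewrite [in X in X -> _]inE => /andP[FK _].
  rewrite [in X in X -> _]inE => /andP[FK' _] E.
  by apply/eqP; rewrite eqEsubset !injF.
have cardF F : F \in noncrossing_complex VS cS -> #|phi @: F| = #|F|.
  move=> /noncrossingP[FV _]; apply: card_in_imset => s s' sF s'F.
  by apply: inj; apply: FV.
apply: eq_card => G; apply/imsetP/idP => [[F] | ].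
  rewrite inE => /and3P[FK Fk FP] ->; rewrite inE cardF // Fk PQ // FP !andbT.
  have /noncrossingP[FV Fc] := FK; apply/noncrossingP; split.
    by move=> _ /imsetP[s sF ->]; apply/phiV/FV.
  move=> _ _ /imsetP[s sF ->] /imsetP[s' s'F ->] ne.
  have ss' : s != s' by apply: contraNneq ne => ->.
  by rewrite cE ?FV //; apply: Fc.
rewrite inE => /and3P[GK Gk GQ]; have /noncrossingP[GV Gc] := GK.
pose F := [set s | VS s & phi s \in G].
have GE : G = phi @: F.
  apply/setP => t; apply/idP/imsetP => [tG | [s]];
    last by rewrite inE => /andP[_ ?] ->.
  by have [s sV st] := onto t (GV t tG); exists s => //; rewrite inE sV st.
have FK : F \in noncrossing_complex VS cS.
  apply/noncrossingP; split=> [s | s s']; first by rewrite inE => /andP[].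
  rewrite !inE => /andP[sV sG] /andP[s'V s'G] ss'; rewrite -cE //.
  by apply: Gc => //; apply: contraNneq ss' => /inj ->.
by exists F; rewrite // inE FK -cardF // -GE Gk -PQ // -GE GQ.
Qed.

(** Counting by a correspondence [E] that is functional in both directions, for
    a bijection that is easier to recognize than to compute. *)
Lemma card_rel_bij (S T : finType) (A : {set S}) (B : {set T})
    (E : S -> T -> Prop) :
  (forall a, a \in A -> exists2 b, b \in B & E a b) ->
  (forall b, b \in B -> exists2 a, a \in A & E a b) ->
  (forall a b b', E a b -> E a b' -> b = b') ->
  (forall a a' b, E a b -> E a' b -> a = a') ->
  #|A| = #|B|.
Proof.
move=> AB BA funE injE.
have [f fP] : exists f : S -> option T,
    forall a, a \in A -> exists b, [/\ f a = Some b, b \in B & E a b].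
  exists (fun a => [pick b in B | `[< E a b >]]) => a /AB[b bB ab].
  case: pickP => [b' /andP[b'B /asboolP ab'] | /(_ b)]; first by exists b'.
  by rewrite bB; move/asboolP: ab => ->.
have SI : injective (@Some T) by move=> ? ? [].
rewrite -(card_imset B SI) -(@card_in_imset _ _ f A).
  congr #|pred_of_set _|; apply/setP => o; apply/imsetP/imsetP => -[x xX ->].
    by have [b [-> bB _]] := fP x xX; exists b.
  have [a aA ax] := BA x xX; exists a => //.
  by have [b [-> _ ab]] := fP a aA; congr Some; apply: funE ax ab.
move=> a a' /fP[b [-> _ ab]] /fP[b' [-> _ ab']] [bb'].
by apply: injE ab _; rewrite bb'.
Qed.

(** * Indices and arcs of a polygon *)

(** Below, the vertices of a polygon are written [v + a%:R], where the natural
    number [a] is the number of steps from a base vertex [v]. As long as the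
    numbers of steps stay below the number of vertices they behave like
    integers, and wrap-around is confined to the choice of [v]. *)
Lemma natr_ord_eq (N a b : nat) : (a < N.+2)%N -> (b < N.+2)%N ->
  (a%:R == b%:R :> 'I_N.+2) = (a == b).
Proof.
move=> ha hb; rewrite !Zp_nat.
by apply/eqP/eqP => [/(congr1 val) /= | -> //]; rewrite !modn_small.
Qed.

Lemma natr_ord_val (N a : nat) : (a < N.+2)%N -> (a%:R : 'I_N.+2) = a :> nat.
Proof. by move=> ha; rewrite Zp_nat /= modn_small. Qed.

Lemma natr_ordK (N : nat) (i : 'I_N.+2) : (i : nat)%:R = i :> 'I_N.+2.
Proof. by apply: val_inj; rewrite /= natr_ord_val. Qed.

Lemma natr_ordN (N : nat) : N.+2%:R = 0 :> 'I_N.+2.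
Proof. by rewrite Zp_nat; apply: val_inj; rewrite /= modnn. Qed.

Lemma card_arc (N : nat) (v : 'I_N.+2) (a b : nat) :
  (a <= b)%N -> (b < a + N.+2)%N ->
  #|Defs.arc (v + a%:R) (v + b%:R)| = (b - a).+1.
Proof.
move=> ab ba.
have sub_v c : (a <= c)%N -> v + c%:R - (v + a%:R) = (c - a)%:R.
  by move=> ac; rewrite opprD addrACA subrr add0r natrB.
rewrite -[RHS]card_ord -(card_imset 'I_(b - a).+1 
  (f := fun i : 'I_(b - a).+1 => v + (a + i)%:R)).
  apply: eq_card => x; rewrite inE sub_v // natr_ord_val; last by lia.
  apply/idP/imsetP => [h | [i _ ->]].
    have hx : ((x - (v + a%:R))%R < (b - a).+1)%N by [].
    exists (Ordinal hx) => //.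
    by rewrite natrD addrA [(nat_of_ord (Ordinal hx))%:R]natr_ordK addrC subrK.
  by rewrite sub_v ?leq_addr // addKn natr_ord_val; have := ltn_ord i; lia.
move=> i j /addrI /eqP; rewrite !natrD (inj_eq (addrI _)).
rewrite natr_ord_eq; try by have := ltn_ord i; have := ltn_ord j; lia.
by move/eqP/val_inj.
Qed.

Lemma card_arc_ord (N : nat) (a b : 'I_N.+2) :
  #|Defs.arc a b| = (if (a <= b)%N then b - a else b + N.+2 - a)%N.+1.
Proof.
have := ltn_ord a; have := ltn_ord b => bN aN.
case: ifP => ab.
  by have := @card_arc N 0 a b; rewrite !add0r !natr_ordK => ->; lia.
have := @card_arc N 0 a (b + N.+2); rewrite !add0r natrD natr_ordN addr0.
by rewrite !natr_ordK => ->; lia.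
Qed.

Lemma nonconsecutive_nat (N : nat) (v : 'I_N.+2) (a b : nat) :
  (a.+1 < b)%N -> (b < N.+2)%N -> (b < a + N.+1)%N ->
  nonconsecutive (v + a%:R) (v + b%:R).
Proof.
move=> ab bN baN; rewrite /nonconsecutive -!addrA !natr1 !(inj_eq (addrI v)).
apply/and3P; split; first by rewrite natr_ord_eq; lia.
  by rewrite natr_ord_eq; lia.
have [bS | nbS] := eqVneq b N.+1; last by rewrite natr_ord_eq; lia.
by rewrite bS natr_ordN -[0](mulr0n 1) natr_ord_eq //; lia.
Qed.

Lemma mem_arc (N : nat) (v : 'I_N.+2) (a b c : nat) :
  (a <= b)%N -> (b < N.+2)%N -> (c < N.+2)%N ->
  (v + c%:R \in Defs.arc (v + a%:R) (v + b%:R)) = (a <= c <= b)%N.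
Proof.
move=> ab bN cN; rewrite inE !opprD !addrA ![v + _ - v]addrAC !subrr !add0r.
rewrite -(natrB _ ab) natr_ord_val; last by lia.
have [ac | ca] := leqP a c; first by rewrite -natrB // natr_ord_val; lia.
have -> : c%:R - a%:R = (c + N.+2 - a)%:R :> 'I_N.+2.
  by rewrite natrB ?natrD ?natr_ordN ?addr0 //; lia.
by rewrite natr_ord_val; lia.
Qed.

(** * Crossing diagonals of a convex polygon *)

Lemma orient_cycle (R : realType) (a b c : 'rV[R]_2) :
  orient a b c = orient b c a.
Proof. by rewrite /orient; ring. Qed.

(** The three-term Pluecker relation for the directions seen from [o]: as
    [b], [c] and [d] lie in the open half-plane to the left of [oa], turning
    left from [b] to [c] and from [c] to [d] means turning left from [b] to
    [d]. *)
Lemma orient_trans (R : realType) (o a b c d : 'rV[R]_2) :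
  0 < orient o a b -> 0 < orient o a c -> 0 < orient o a d ->
  0 < orient o b c -> 0 < orient o c d -> 0 < orient o b d.
Proof.
move=> ab ac ad bc cd; rewrite -(pmulr_rgt0 _ ac).
have -> : orient o a c * orient o b d =
          orient o a b * orient o c d + orient o a d * orient o b c.
  by rewrite /orient; ring.
by rewrite addr_gt0 ?mulr_gt0.
Qed.

Section ConvexPolygon.

Variables (R : realType) (N : nat) (p : 'I_N.+2 -> 'rV[R]_2).
Hypothesis convp : convex_polygon p.

Lemma convex_side (v : 'I_N.+2) (a c : nat) :
  (a.+1 < N.+2)%N -> (c < N.+2)%N -> c != a -> c != a.+1 ->
  0 < orient (p (v + a%:R)) (p (v + a.+1%:R)) (p (v + c%:R)).
Proof.
move=> ha hc nca nca1.
have -> : v + a.+1%:R = v + a%:R + 1 by rewrite -addrA natr1.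
apply: convp; first by rewrite (inj_eq (addrI v)) natr_ord_eq // ltnW.
by rewrite -addrA natr1 (inj_eq (addrI v)) natr_ord_eq.
Qed.

(** Convexity, which only speaks of sides, implies that all triples of vertices
    are oriented anticlockwise. Seen from vertex [a], the others lie to the left
    of the side leaving [a], and each is followed by a left turn because [a] is
    to the left of all sides that do not contain it; [orient_trans] adds up
    these turns. *)
Lemma convex_orient (v : 'I_N.+2) (a b c : nat) :
  (a < b)%N -> (b < c)%N -> (c < N.+2)%N ->
  0 < orient (p (v + a%:R)) (p (v + b%:R)) (p (v + c%:R)).
Proof.
move=> ab; elim: c => // c IHc; rewrite ltnS leq_eqVlt => /predU1P[<- | bc] hc.
  by rewrite orient_cycle; apply: convex_side; lia.
have [-> | nb] := eqVneq b a.+1; first by apply: convex_side; lia.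
apply: (orient_trans (a := p (v + a.+1%:R)) (c := p (v + c%:R)));
  do ?[by apply: convex_side; lia]; first by apply: IHc; lia.
by rewrite orient_cycle; apply: convex_side; lia.
Qed.

End ConvexPolygon.

Definition interleaved (p q : nat * nat) : bool :=
  [&& p.1 < q.1, q.1 < p.2 & p.2 < q.2]%N ||
  [&& q.1 < p.1, p.1 < q.2 & q.2 < p.2]%N.

Lemma set2_eq (T : finType) (a b c d : T) :
  [set a; b] = [set c; d] -> (a = c /\ b = d) \/ (a = d /\ b = c).
Proof.
move=> E.
have := set21 a b; rewrite E in_set2 => /orP[] /eqP ac;
  have := set22 a b; rewrite E in_set2 => /orP[] /eqP bd.
- have := set22 c d; rewrite -E in_set2 ac bd orbb => /eqP ->; tauto.
- tauto.
- tauto.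
- have := set21 c d; rewrite -E in_set2 ac bd orbb => /eqP ->; tauto.
Qed.

Lemma relint2P (R : realType) (N : nat) (p : 'I_N.+2 -> 'rV[R]_2) i j x :
  in_relint p [set i; j] x <->
  exists t : R, 0 < t < 1 /\ x = (1 - t) *: p i + t *: p j.
Proof.
split=> [[k [l [t [/set2_eq E t01 ->]]]] | [t [t01 ->]]];
  last by exists i, j, t.
case: E => [[-> ->] | [-> ->]]; first by exists t.
exists (1 - t); split; first by move: t01 => /andP[? ?]; apply/andP; split; lra.
by rewrite opprB addrCA subrr addr0 addrC.
Qed.

Lemma orient_line (R : realType) (a b : 'rV[R]_2) (t : R) :
  orient a b ((1 - t) *: a + t *: b) = 0.
Proof. by rewrite /orient !mxE; ring. Qed.

Lemma orient_affine (R : realType) (a b c d : 'rV[R]_2) (t : R) :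
  orient a b ((1 - t) *: c + t *: d) =
  (1 - t) * orient a b c + t * orient a b d.
Proof. by rewrite /orient !mxE; ring. Qed.

Lemma orient_swap (R : realType) (a b c : 'rV[R]_2) :
  orient b a c = - orient a b c.
Proof. by rewrite /orient; ring. Qed.

(** The affine dependency of four points of the plane: the two coefficients of
    the left-hand side have the same sum as those of the right-hand side, so for
    a convex quadrilateral both sides are a multiple of the intersection point
    of the diagonals [ac] and [bd]. *)
Lemma orient_relation (R : realType) (a b c d : 'rV[R]_2) :
  orient b c d *: a + orient a b d *: c = orient a c d *: b + orient a b c *: d.
Proof.
apply/rowP => -[[|[|//]] k2]; rewrite !mxE /orient.
  have -> : Ordinal k2 = 0 by apply: val_inj.
  ring.
have -> : Ordinal k2 = 1 by apply: val_inj.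
ring.
Qed.

Lemma orient_eq (R : realType) (a b : 'rV[R]_2) :
  (orient a b a = 0) * (orient a b b = 0).
Proof. by split; rewrite /orient; ring. Qed.

Section CrossInterleave.

Variables (R : realType) (N : nat) (p : 'I_N.+2 -> 'rV[R]_2).
Hypothesis convp : convex_polygon p.
Variable v : 'I_N.+2.

Lemma cross_sym d e : cross p d e = cross p e d.
Proof. by apply/asboolP/asboolP => -[x [? ?]]; exists x. Qed.

Lemma interleave_cross (a b c d : nat) :
  (a < b)%N -> (b < c)%N -> (c < d)%N -> (d < N.+2)%N ->
  cross p [set v + a%:R; v + c%:R] [set v + b%:R; v + d%:R].
Proof.
move=> ab bc cd dN.
have hbcd : 0 < orient (p (v + b%:R)) (p (v + c%:R)) (p (v + d%:R)).
  by apply: convex_orient.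
have habd : 0 < orient (p (v + a%:R)) (p (v + b%:R)) (p (v + d%:R)).
  by apply: convex_orient => //; lia.
have hacd : 0 < orient (p (v + a%:R)) (p (v + c%:R)) (p (v + d%:R)).
  by apply: convex_orient => //; lia.
have habc : 0 < orient (p (v + a%:R)) (p (v + b%:R)) (p (v + c%:R)).
  by apply: convex_orient => //; lia.
(* the common sum of the coefficients on either side of [orient_relation] *)
pose S := orient (p (v + b%:R)) (p (v + c%:R)) (p (v + d%:R)) +
          orient (p (v + a%:R)) (p (v + b%:R)) (p (v + d%:R)).
have Sgt0 : 0 < S by rewrite addr_gt0.
pose t := orient (p (v + a%:R)) (p (v + b%:R)) (p (v + d%:R)) / S.
pose u := orient (p (v + a%:R)) (p (v + b%:R)) (p (v + c%:R)) / S.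
have SE : S = orient (p (v + a%:R)) (p (v + b%:R)) (p (v + c%:R)) +
              orient (p (v + a%:R)) (p (v + c%:R)) (p (v + d%:R)).
  by rewrite /S /orient; ring.
apply/asboolP; exists ((1 - t) *: p (v + a%:R) + t *: p (v + c%:R)).
split; apply/relint2P.
  by exists t; split=> //; rewrite /t divr_gt0 // ltr_pdivrMr // mul1r ltrDr.
exists u; split; first by rewrite /u divr_gt0 // ltr_pdivrMr // mul1r SE ltrDl.
have S0 : S != 0 by rewrite gt_eqF.
apply: (scalerI S0); rewrite !scalerDr !scalerA !(mulrBr S) !mulr1.
rewrite ![S * (_ / S)]mulrC !divfK //.
have -> : S - orient (p (v + a%:R)) (p (v + b%:R)) (p (v + d%:R)) =
          orient (p (v + b%:R)) (p (v + c%:R)) (p (v + d%:R)).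
  by rewrite /S addrK.
by rewrite SE addrAC subrr add0r orient_relation.
Qed.

(** A segment whose endpoints lie in a closed half-plane bounded by a line, and
    not both on that line, has its relative interior off the line. The sign of
    [s] selects the half-plane. *)
Lemma side_noncross (d : {set 'I_N.+2}) i j k l (s : R) :
  s != 0 -> d = [set i; j] ->
  0 <= s * orient (p i) (p j) (p k) -> 0 <= s * orient (p i) (p j) (p l) ->
  orient (p i) (p j) (p k) != 0 \/ orient (p i) (p j) (p l) != 0 ->
  ~~ cross p d [set k; l].
Proof.
move=> s0 -> hk hl nz; apply/negP => /asboolP[x [/relint2P[t [_ xt]]]].
case/relint2P=> u [/andP[u0 u1] xu].
have := orient_line (p i) (p j) t; rewrite -xt xu orient_affine => E.
have u1' : 0 < 1 - u by rewrite subr_gt0.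
have : s * ((1 - u) * orient (p i) (p j) (p k)) +
       s * (u * orient (p i) (p j) (p l)) == 0 by rewrite -mulrDr E mulr0.
rewrite !(mulrCA s) paddr_eq0; first last.
- by rewrite (pmulr_rge0 _ u0).
- by rewrite (pmulr_rge0 _ u1').
rewrite !mulf_eq0 (gt_eqF u0) (gt_eqF u1') (negbTE s0) /=.
by move=> /andP[/eqP k0 /eqP l0]; move: nz; rewrite k0 l0 eqxx => -[].
Qed.

(** If the endpoints do not interleave, then those of one diagonal lie weakly on
    one side of the line spanned by the other, and not both lie on that line
    since the diagonals are distinct. *)
Lemma cross_interleaved (a b c d : nat) :
  (a < b)%N -> (b < N.+2)%N -> (c < d)%N -> (d < N.+2)%N ->
  (a, b) != (c, d) ->
  cross p [set v + a%:R; v + b%:R] [set v + c%:R; v + d%:R] =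
  interleaved (a, b) (c, d).
Proof.
move=> ab bN cd dN ne; rewrite /interleaved /=.
have [/and3P[ac cb bd] | h1] /= := boolP [&& _, _ & _].
  exact: interleave_cross.
have [/and3P[ca ad db] | h2] /= := boolP [&& _, _ & _].
  by rewrite cross_sym; apply: interleave_cross.
apply/negbTE.
pose o e := orient (p (v + a%:R)) (p (v + b%:R)) (p (v + e%:R)).
have oin e : (a < e)%N -> (e < b)%N -> o e < 0.
  move=> ae eb; rewrite /o -oppr_gt0 -orient_swap orient_cycle.
  exact: convex_orient.
have oout e : (e < N.+2)%N -> (e < a)%N || (b < e)%N -> 0 < o e.
  move=> eN /orP[ea | be]; last exact: convex_orient.
  by rewrite /o -orient_cycle; apply: convex_orient.
have oa : o a = 0 by rewrite /o orient_eq.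
have ob : o b = 0 by rewrite /o orient_eq.
have [inn | out] := boolP ((a <= c) && (d <= b))%N.
  apply: (@side_noncross _ (v + a%:R) (v + b%:R) _ _ (-1)) => //.
  - by rewrite oppr_eq0 oner_eq0.
  - rewrite mulN1r oppr_ge0 -/(o c).
    have [-> | nac] := eqVneq c a; first by rewrite oa.
    by apply/ltW/oin; lia.
  - rewrite mulN1r oppr_ge0 -/(o d).
    have [-> | nac] := eqVneq d b; first by rewrite ob.
    by apply/ltW/oin; lia.
  - have [ca | nac] := eqVneq c a.
      right; rewrite lt_eqF //; apply: oin; first by lia.
      by move: ne; rewrite ca xpair_eqE eqxx /=; lia.
    by left; rewrite lt_eqF //; apply: oin; lia.
have oge e : (e < N.+2)%N -> (e <= a)%N || (b <= e)%N -> 0 <= o e.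
  move=> eN h; have [-> | nea] := eqVneq e a; first by rewrite oa.
  have [-> | neb] := eqVneq e b; first by rewrite ob.
  by apply/ltW/oout; lia.
apply: (@side_noncross _ (v + a%:R) (v + b%:R) _ _ 1) => //.
- exact: oner_neq0.
- by rewrite mul1r; apply: oge; lia.
- by rewrite mul1r; apply: oge; lia.
- have [|] := boolP ((c < a) || (b < c))%N => hc.
    by left; rewrite gt_eqF //; apply: oout; lia.
  by right; rewrite gt_eqF //; apply: oout; lia.
Qed.

End CrossInterleave.

(** * Laminar families of intervals *)

Section Intervals.

Local Open Scope nat_scope.

Variables K m : nat.

Notation interval := ('I_K * 'I_K)%type.
Implicit Types (e f : interval) (F : {set interval}) (v x y : nat).

Lemma interval_eq e f : e.1 = f.1 :> nat -> e.2 = f.2 :> nat -> e = f.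
Proof.
case: e f => [a b] [c d] /= ac bd.
by congr (_, _); apply: val_inj.
Qed.

(** An interval of length [m k + 1] with [k >= 1] stands for a diagonal that
    cuts off an [(m k + 2)]-gon. *)
Definition admissible x y e : bool :=
  [&& x <= e.1, e.2 <= y, e.1.+1 < e.2 & m %| (e.2 - e.1).-1].

Definition interval_cross : rel interval :=
  fun e f => interleaved (e.1 : nat, e.2 : nat) (f.1 : nat, f.2 : nat).

Definition laminar x y : {set {set interval}} :=
  noncrossing_complex (admissible x y) interval_cross.

(** When the polygon spanned by the window is cut along the diagonals of [F],
    the exposed points are the vertices of the piece on the side that joins the
    two ends of the window; this piece is a 2-gon if [F] contains the full
    interval. *)
Definition exposed F v : bool := [forall e in F, ~~ (e.1 < v < e.2)].

Definition nb_exposed F x y : nat := \sum_(x <= v < y) exposed F v.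

Lemma laminarP x y F :
  reflect ((forall e, e \in F -> admissible x y e) /\
           (forall e f, e \in F -> f \in F -> ~~ interval_cross e f))
          (F \in laminar x y).
Proof.
rewrite inE; apply: (iffP andP) => -[h1 h2]; split.
- exact/forall_inP.
- move=> e f eF fF; have [<-|ne] := eqVneq e f.
    by rewrite /interval_cross /interleaved /=; lia.
  by move/forall_inP: h2 => /(_ e eF) /forall_inP/(_ f fF)/implyP/(_ ne).
- exact/forall_inP.
- by apply/forall_inP => e eF; apply/forall_inP => f fF; rewrite h2 ?implybT.
Qed.

Lemma exposedP F v :
  reflect (forall e, e \in F -> e.1 < v -> v < e.2 -> False) (exposed F v).
Proof.
apply: (iffP forall_inP) => h e eF; last by apply/negP => /andP[]; exact: h.
by move=> h1 h2; move: (h e eF); rewrite h1 h2.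
Qed.

Lemma exposed_left x y F : F \in laminar x y -> exposed F x.
Proof. by case/laminarP => h _; apply/exposedP => e /h /and4P[]; lia. Qed.

Lemma exposed_right x y F : F \in laminar x y -> exposed F y.
Proof. by case/laminarP => h _; apply/exposedP => e /h /and4P[]; lia. Qed.

Lemma nb_exposed_cat F x y z : x <= y -> y <= z ->
  nb_exposed F x z = nb_exposed F x y + nb_exposed F y z.
Proof. by move=> xy yz; rewrite /nb_exposed (big_cat_nat (n := y)). Qed.

Lemma nb_exposed_ltn F x y : x < y ->
  nb_exposed F x y = exposed F x + nb_exposed F x.+1 y.
Proof. by move=> xy; rewrite /nb_exposed big_ltn. Qed.

Lemma nb_exposed_id F x : nb_exposed F x x = 0.
Proof. by rewrite /nb_exposed big_geq. Qed.

Lemma nb_exposed_le F x y : nb_exposed F x y <= y - x.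
Proof.
rewrite /nb_exposed -[y - x]muln1 -sum_nat_const_nat.
by apply: leq_sum => v _; case: exposed.
Qed.

Lemma eq_nb_exposed F F' x y : (forall v, x <= v < y ->
  exposed F v = exposed F' v) ->
  nb_exposed F x y = nb_exposed F' x y.
Proof. by move=> h; apply: eq_big_nat => v /h ->. Qed.

Lemma nb_exposed_hidden F x y : x < y -> exposed F x ->
  (forall v, x < v -> v < y -> ~~ exposed F v) -> nb_exposed F x y = 1.
Proof.
move=> xy ex h; rewrite nb_exposed_ltn // ex /nb_exposed big_nat_cond big1 //
  => v.
by rewrite andbT => /andP[xv vy]; rewrite (negbTE (h v xv vy)).
Qed.

Lemma nb_exposed_inj F y b c : b <= y -> c <= y -> exposed F b -> exposed F c ->
  nb_exposed F b y = nb_exposed F c y -> b = c.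
Proof.
wlog bc : b c / b <= c.
  move=> wl hb hc eb ec h; have [bc | /ltnW cb] := leqP b c; first exact: wl.
  by apply/esym/wl.
rewrite leq_eqVlt in bc; case/predU1P: bc => [// | bc] hb hc eb ec.
by rewrite (nb_exposed_cat _ (ltnW bc)) // nb_exposed_ltn // eb; lia.
Qed.

Lemma nb_exposed_surj F x y t : x <= y -> exposed F y ->
  t <= nb_exposed F x y ->
  exists b, [/\ x <= b, b <= y, exposed F b & nb_exposed F b y = t].
Proof.
move=> xy ey; case: t => [_ | t]; first by exists y; rewrite nb_exposed_id.
move: xy; have [k] := ubnP (y - x); elim: k x => // k IHk x hk xy.
rewrite leq_eqVlt in xy; case/predU1P: xy => [-> | xy].
  by rewrite nb_exposed_id.
rewrite nb_exposed_ltn //; case ex: (exposed F x) => ht; last first.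
  by have [| | |b [? ? ? ?]] := IHk x.+1; [lia..|exists b; split; lia].
rewrite leq_eqVlt in ht; case/predU1P: ht => [ht | ht].
  by exists x; split; rewrite // ?(ltnW xy) // nb_exposed_ltn // ex; lia.
by have [| | |b [? ? ? ?]] := IHk x.+1; [lia..|exists b; split; lia].
Qed.

Lemma longest_from F x : [exists e in F, e.1 == x :> nat] ->
  exists e, [/\ e \in F, e.1 = x :> nat &
                forall g, g \in F -> g.1 = x :> nat -> g.2 <= e.2].
Proof.
move=> /exists_inP[f0 f0F f01].
pose P := [pred f : interval | (f \in F) && (f.1 == x :> nat)].
have P0 : P f0 by rewrite /= f0F f01.
case: (arg_maxnP (fun f : interval => f.2 : nat) P0) => e.
move=> /andP[eF /eqP e1] emax.
by exists e; split=> // g gF g1; apply: emax; rewrite /= gF g1 eqxx.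
Qed.

(** Two consecutive exposed points are joined by a unit step or by an interval
    of [F], namely the longest one that starts at the first of them. *)
Lemma next_exposed x0 y0 F x y : F \in laminar x0 y0 ->
  exposed F x -> exposed F y -> x < y ->
  exists z, [/\ x < z, z <= y, exposed F z, nb_exposed F x z = 1 &
    z = x.+1 \/ exists2 f, f \in F & f.1 = x :> nat /\ f.2 = z :> nat].
Proof.
move=> /laminarP[adm nocr] ex ey xy.
have [/longest_from[f [fF f1 fmax]] | none] :=
  boolP [exists f in F, f.1 == x :> nat].
  have /and4P[_ _ fw _] := adm f fF.
  exists f.2; split; last by right; exists f.
  - lia.
  - by rewrite leqNgt; apply/negP => fy; apply: (exposedP _ _ ey f fF); lia.
  - apply/exposedP => g gF g1 g2.
    have := exposedP _ _ ex g gF; have := nocr f g fF gF.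
    rewrite /interval_cross /interleaved /= => cr gx.
    have [/(fmax g gF) | ngx] := eqVneq (g.1 : nat) x;
      first by rewrite leqNgt g2.
    by apply: gx => //; lia.
  - apply: nb_exposed_hidden => //; first by lia.
    by move=> v xv vf; apply/negP => /exposedP/(_ f fF); lia.
exists x.+1; split=> //; [|by apply: nb_exposed_hidden => //; lia | by left].
apply/exposedP => e eF e1 e2.
have [e1x | ne] := eqVneq (e.1 : nat) x.
  by move/exists_inP: none; apply; exists e; rewrite ?e1x.
by apply: (exposedP _ _ ex e eF); lia.
Qed.

(** By [next_exposed], consecutive exposed points are at distance 1 modulo
    [m]. *)
Lemma nb_exposed_mod x0 y0 F x y : F \in laminar x0 y0 ->
  exposed F x -> exposed F y -> x <= y -> y - x = nb_exposed F x y %[mod m].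
Proof.
move=> lamF; have [k] := ubnP (y - x); elim: k x => // k IHk x hk ex ey.
rewrite leq_eqVlt => /predU1P[-> | xy]; first by rewrite nb_exposed_id subnn.
have [z [xz zy ez n1 hz]] := next_exposed lamF ex ey xy.
rewrite (nb_exposed_cat _ (ltnW xz)) // n1 -modnDmr -IHk //; last by lia.
rewrite modnDmr; have dz : m %| (z - x).-1.
  case: hz => [-> | [f fF [<- <-]]]; first by rewrite subSnn dvdn0.
  by have /laminarP[adm _] := lamF; have /and4P[] := adm f fF.
have -> : y - x = (z - x).-1 + (1 + (y - z)) by lia.
by rewrite -modnDml (eqP dz).
Qed.

Definition nb_laminar x y r s : nat :=
  #|[set F in laminar x y | (#|F| == s) && (nb_exposed F x y == r)]|.

Lemma laminar_succ x y F : F \in laminar x.+1 y ->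
  F \in laminar x y /\ nb_exposed F x y = nb_exposed F x.+1 y + (x < y).
Proof.
case/laminarP => adm nocr; have lam : F \in laminar x y.
  apply/laminarP; split=> // e /adm /and4P[? ? ? ?]; apply/and4P; split=> //;
    lia.
split=> //; case: ltnP => xy; last by rewrite /nb_exposed !big_geq // ltnW.
by rewrite nb_exposed_ltn // (exposed_left lam) addnC.
Qed.

Lemma laminar_split x y F : F \in laminar x y ->
  F \in laminar x.+1 y \/ exists2 e, e \in F & e.1 = x :> nat.
Proof.
case/laminarP => adm nocr.
have [/exists_inP[e eF /eqP e1] | none] :=
  boolP [exists e in F, e.1 == x :> nat].
  by right; exists e.
left; apply/laminarP; split=> // e eF; have /and4P[? ? ? ?] := adm e eF.
apply/and4P; split=> //; rewrite ltn_neqAle eq_sym; apply/andP; split=> //.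
by apply: contra none => ?; apply/exists_inP; exists e.
Qed.

(** Removing the longest interval [(x, b)] that starts at [x] exposes again the
    points that it hid, at least one of them inside it. Conversely [(x, b)] can
    be recovered from what remains and from [r]: its end [b] is the exposed
    point for which [[b, y)] contains [r] exposed points. The length of [(x, b)]
    is then 1 modulo [m] by [nb_exposed_mod]. *)
Lemma card_remove_longest x y r s : x < y -> y < K -> y - x = r.+1 %[mod m] ->
  #|[set F in laminar x y | [&& #|F| == s.+1, nb_exposed F x y == r.+1 &
                             [exists e in F, e.1 == x :> nat]]]| =
  #|[set F in laminar x y | (#|F| == s) && (r.+1 < nb_exposed F x y)]|.
Proof.
move=> xy yK hr.
(* [F] arises from [F'] by adding the longest interval [e] starting at [x] *)
pose E F F' := exists e, [/\ e.1 = x :> nat, e \notin F', F = e |: F' &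
  [/\ exposed F' e.2, nb_exposed F' e.2 y = r, x.+1 < e.2 & e.2 <= y]].
apply: (card_rel_bij (E := E)).
- move=> F; rewrite inE => /and4P[lamF /eqP Fs /eqP Fr].
  have /laminarP[adm nocr] := lamF.
  move=> /longest_from[e [eF e1 emax]].
  have /and4P[_ ey ew _] := adm e eF.
  have FE : F = e |: (F :\ e) by rewrite setD1K.
  have lamF' : F :\ e \in laminar x y.
    apply/laminarP; split; first by move=> f /setD1P[_ /adm].
    by move=> f g /setD1P[_ fF] /setD1P[_ gF]; apply: nocr.
  have ee : exposed (F :\ e) e.2.
    apply/exposedP => g /setD1P[ge gF] g1 g2.
    have := nocr e g eF gF; have /and4P[gx _ _ _] := adm g gF.
    rewrite /interval_cross /interleaved /=.
    have [/(emax g gF) | ngx cr] := eqVneq (g.1 : nat) x; last by lia.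
    by rewrite leqNgt g2.
  have eqx v : e.2 <= v -> exposed F v = exposed (F :\ e) v.
    move=> ev; apply/exposedP/exposedP => h g.
      by move=> /setD1P[_ gF]; apply: h.
    move=> gF; have [-> | ge] := eqVneq g e; first by lia.
    by apply: h; rewrite !inE ge.
  have hF1 : nb_exposed F x e.2 = 1.
    apply: nb_exposed_hidden; [lia | exact: exposed_left lamF |].
    by move=> v xv ve; apply/negP => /exposedP/(_ e eF); lia.
  have hF2 : nb_exposed (F :\ e) e.2 y = r.
    rewrite -(eq_nb_exposed (F := F)); last by move=> v /andP[? _]; exact: eqx.
    by move: Fr; rewrite (@nb_exposed_cat _ _ e.2) ?hF1 //; lia.
  exists (F :\ e); last first.
    by exists e; split=> //; [rewrite !inE eqxx | split=> //; lia].
  rewrite inE lamF' /=; apply/andP; split.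
    by move: Fs; rewrite (cardsD1 e) eF add1n => -[->].
  rewrite (@nb_exposed_cat _ _ e.2) ?hF2 //; last by lia.
  have xe : x < e.2 by lia.
  (* a second point before the end of [e] that its removal leaves exposed *)
  have [z [xz ze ez n1 hz]] := next_exposed lamF' (exposed_left lamF') ee xe.
  have zlt : z < e.2.
    rewrite ltn_neqAle ze andbT; apply/eqP => zE; case: hz => [|]; first by lia.
    case=> f /setD1P[fe fF] [f1 f2]; case/eqP: fe.
    by apply: interval_eq; rewrite ?f1 ?e1 ?f2 ?zE.
  rewrite (@nb_exposed_cat _ _ z) ?n1 //; last by lia.
  by rewrite (nb_exposed_ltn _ zlt) ez; lia.
- move=> F'; rewrite inE => /and3P[lamF' /eqP Fs Fr].
  have ex := exposed_left lamF'; have ey := exposed_right lamF'.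
  have [||z [xz zy ez nz]] := @nb_exposed_surj F' x y r _ ey; [lia..|].
  have nxz : 2 <= nb_exposed F' x z.
    by move: Fr; rewrite (@nb_exposed_cat _ _ z) // nz; lia.
  have xz2 : x.+1 < z by have := nb_exposed_le F' x z; lia.
  have xK : x < K by lia.
  have zK : z < K by lia.
  pose e : interval := (Ordinal xK, Ordinal zK).
  have admE : admissible x y e.
    rewrite /admissible /= leqnn zy xz2 /=.
    have zxE : z - x = (z - x).-1 + 1 by rewrite addn1 prednK // subn_gt0; lia.
    have h1 := nb_exposed_mod lamF' ex ez xz.
    have h2 := nb_exposed_mod lamF' ex ey (ltnW xy).
    have : z - x = 1 %[mod m].
      rewrite h1; apply/eqP; rewrite -(eqn_modDr r) -{1}nz -nb_exposed_cat //.
      by rewrite -h2 hr add1n.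
    move=> /eqP; rewrite zxE.
    by rewrite -{2}[1]add0n eqn_modDr mod0n => /eqP h; rewrite addn1 /= /dvdn h.
  have eF' : e \notin F'.
    apply/negP => eF; suff : nb_exposed F' x z = 1 by lia.
    apply: nb_exposed_hidden ex _; first by lia.
    by move=> v xv vz; apply/negP => /exposedP/(_ e eF) /=; lia.
  have /laminarP[adm nocr] := lamF'.
  have cre f : f \in F' -> ~~ interval_cross e f.
    move=> fF; have /and4P[fx _ fw _] := adm f fF.
    by have := exposedP _ _ ez f fF; rewrite /interval_cross /interleaved /=;
      lia.
  have crs f : interval_cross e f = interval_cross f e.
    by rewrite /interval_cross /interleaved /= orbC.
  have lamF : e |: F' \in laminar x y.
    apply/laminarP; split.
      by move=> f /setU1P[-> // | /adm].
    move=> f g /setU1P[-> | fF] /setU1P[-> | gF].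
    - by rewrite /interval_cross /interleaved /=; lia.
    - exact: cre.
    - by rewrite -crs; apply: cre.
    - exact: nocr.
  exists (e |: F'); last by exists e; split=> //; split.
  rewrite inE lamF cardsU1 eF' Fs add1n eqxx /=; apply/andP; split; last first.
    by apply/exists_inP; exists e; rewrite ?setU11 //.
  rewrite (@nb_exposed_cat _ _ z) //; apply/eqP.
  have -> : nb_exposed (e |: F') x z = 1.
    apply: nb_exposed_hidden (exposed_left lamF) _; first by lia.
    by move=> v xv vz; apply/negP => /exposedP/(_ e (setU11 _ _)) /=; lia.
  rewrite add1n; congr _.+1; rewrite -nz; apply: eq_nb_exposed => v /andP[zv _].
  apply/exposedP/exposedP => h g gF; first by apply: h; rewrite setU1r.
  by case/setU1P: gF => [-> /= | gF]; [lia | apply: h].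
- move=> F F1 F2 [e [e1 eF1 -> [ee _ ew _]]] [f [f1 fF2 EF [ef _ fw _]]].
  have ef2 : e = f.
    have hf : f \in e |: F1 by rewrite EF setU11.
    have he : e \in f |: F2 by rewrite -EF setU11.
    case/setU1P: hf => [-> // | hf]; case/setU1P: he => [-> // | he].
    apply: interval_eq; first by rewrite e1 f1.
    have := exposedP _ _ ee f hf; have := exposedP _ _ ef e he; rewrite e1 f1.
    by lia.
  by rewrite -(setU1K eF1) EF ef2 setU1K.
- move=> F1 F2 F' [e [e1 _ -> [ee ne _ ey]]] [f [f1 _ -> [ef nf _ fy]]].
  congr (_ |: _); apply: interval_eq; first by rewrite e1 f1.
  by apply: nb_exposed_inj ey fy ee ef _; rewrite ne nf.
Qed.

Lemma nb_laminar0 x y r : x <= y -> nb_laminar x y r 0 = (r == y - x).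
Proof.
move=> xy.
have lam0 : set0 \in laminar x y.
  by apply/laminarP; split=> [e|e f]; rewrite inE.
have n0 : nb_exposed set0 x y = y - x.
  rewrite /nb_exposed -[RHS]muln1 -sum_nat_const_nat; apply: eq_bigr => v _.
  by rewrite (_ : exposed _ _) //; apply/exposedP => e; rewrite inE.
rewrite /nb_laminar; case: eqP => [-> | ne]; last first.
  apply/eqP; rewrite cards_eq0 -subset0; apply/subsetP => F.
  rewrite inE cards_eq0.
  by case/and3P=> _ /eqP -> /eqP; rewrite n0 => /esym.
rewrite -[RHS](cards1 (set0 : {set interval})); apply: eq_card => F.
rewrite [RHS]inE inE cards_eq0.
by apply/and3P/eqP => [[_ /eqP] // | ->]; rewrite n0 !eqxx lam0.
Qed.

Lemma nb_laminar_none x y r s :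
  (forall F, F \in laminar x y -> #|F| = s -> nb_exposed F x y = r -> False) ->
  nb_laminar x y r s = 0.
Proof.
move=> h; apply/eqP; rewrite cards_eq0 -subset0; apply/subsetP => F.
by rewrite inE => /and3P[lamF /eqP Fs /eqP Fr]; case: (h F).
Qed.

Lemma nb_laminar_r0 x y s : x < y -> nb_laminar x y 0 s = 0.
Proof.
move=> xy; apply: nb_laminar_none => F lamF _.
by rewrite nb_exposed_ltn // (exposed_left lamF).
Qed.

Lemma nb_laminar_full x y s : nb_laminar x y (y - x) s.+1 = 0.
Proof.
apply: nb_laminar_none => F lamF Fs.
have /card_gt0P[[a b] eF] : 0 < #|F| by rewrite Fs.
have /laminarP[adm _] := lamF; have /and4P[/= xa bY ab _] := adm _ eF.
rewrite (@nb_exposed_cat _ _ a.+1) 1?(@nb_exposed_ltn _ a.+1); [|lia..].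
have -> : exposed F a.+1 = false.
  by apply/negbTE/negP => /exposedP/(_ _ eF) /=; lia.
by have := nb_exposed_le F x a.+1; have := nb_exposed_le F a.+2 y; lia.
Qed.

Lemma nb_laminar_mod x y r s : x <= y -> r != y - x %[mod m] ->
  nb_laminar x y r s = 0.
Proof.
move=> xy nr; apply: nb_laminar_none => F lamF _ Fr; move: nr.
by rewrite (nb_exposed_mod lamF (exposed_left lamF) (exposed_right lamF)) //
  Fr eqxx.
Qed.

(** Either no interval starts at [x], and [x] can be deleted from the window, or
    the longest interval that starts at [x] can be removed; this leaves more
    exposed points, in a number that is congruent to [r + 1] modulo [m]. *)
Lemma nb_laminar_rec x y r s w : 0 < m -> x < y -> y < K ->
  y - x = r.+1 + m * w ->
  nb_laminar x y r.+1 s.+1 = nb_laminar x.+1 y r s.+1 +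
    \sum_(j < w) nb_laminar x y (r.+1 + m * j.+1) s.
Proof.
move=> m_gt0 xy yK hw.
rewrite /nb_laminar -(cardsID [set F : {set interval} |
  [exists e in F, e.1 == x :> nat]] [set F in laminar x y | _]) addnC.
congr (_ + _).
  apply: eq_card => F; rewrite [RHS]inE.
  apply/setDP/idP.
    rewrite 2!inE => -[/and3P[lamF Fs Fr] none].
    case: (laminar_split lamF) => [lamF1 | [e eF e1]]; last first.
      by case/exists_inP: none; exists e; rewrite ?e1.
    have [_ nE] := laminar_succ lamF1.
    by move: Fr; rewrite nE xy addn1 eqSS => Fr; apply/and3P; split.
  move=> /and3P[lamF1 Fs Fr]; have [lamF nE] := laminar_succ lamF1.
  rewrite 2!inE nE xy addn1 eqSS lamF Fs Fr; split=> //.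
  apply/negP => /exists_inP[[a b] eF /eqP /= e1].
  by have /laminarP[adm _] := lamF1; have /and4P[/=] := adm _ eF; lia.
have -> : #|[set F in laminar x y | (#|F| == s.+1) &&
                                    (nb_exposed F x y == r.+1)]
            :&: [set F : {set interval} | [exists e in F, e.1 == x :> nat]]| =
  #|[set F in laminar x y | [&& #|F| == s.+1, nb_exposed F x y == r.+1 &
                             [exists e in F, e.1 == x :> nat]]]|.
  by apply: eq_card => F; rewrite !inE -!andbA.
rewrite card_remove_longest //; last by rewrite hw mulnC addnC modnMDl.
have hF F : F \in laminar x y -> r.+1 < nb_exposed F x y ->
    exists2 j, j < w & nb_exposed F x y = r.+1 + m * j.+1.
  move=> lamF rF; have nle := nb_exposed_le F x y.
  have ex := exposed_left lamF; have ey := exposed_right lamF.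
  have := nb_exposed_mod lamF ex ey (ltnW xy).
  rewrite hw [m * w]mulnC addnC modnMDl => /esym/eqP.
  rewrite (eqn_mod_dvd _ (ltnW rF)).
  case/dvdnP => -[|j] hj; first by lia.
  by exists j; [rewrite -(ltn_pmul2l m_gt0); nia | nia].
(* [w] must be a successor for [inord] to make sense in ['I_w] *)
case: w hw hF => [|w] hw hF.
  rewrite big_ord0; apply/eqP; rewrite cards_eq0 -subset0; apply/subsetP => F.
  by rewrite inE => /and3P[lamF _ /(hF _ lamF)[]].
rewrite -sum1_card.
rewrite (partition_big (fun F =>
  inord ((nb_exposed F x y - r.+1) %/ m).-1 : 'I_w.+1) predT) //=.
apply: eq_bigr => j _; rewrite sum1_card; apply: eq_card => F.
rewrite [RHS]inE unfold_in inE; apply/andP/and3P.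
  case=> /and3P[lamF Fs /(hF _ lamF)[k kw nE]] /eqP <-; split=> //.
  by rewrite nE addKn mulKn //= inordK.
case=> lamF Fs /eqP nE; split.
  by rewrite lamF Fs nE /=; nia.
by rewrite nE addKn mulKn //= inord_val.
Qed.

End Intervals.

(** * Counting laminar families *)

Section ClosedForm.

Local Open Scope nat_scope.

Lemma sum_bin_rev w s : \sum_(j < w) 'C(w - j.+1, s) = 'C(w, s.+1).
Proof.
elim: w => [|w IHw]; first by rewrite big_ord0.
by rewrite big_ord_recl /= subSS subn0 binS -IHw addnC.
Qed.

Lemma sum_bin_rev_weighted w s :
  \sum_(j < w) j.+1 * 'C(w - j.+1, s) = 'C(w.+1, s.+2).
Proof.
elim: w => [|w IHw]; first by rewrite big_ord0.
rewrite big_ord_recl /= subSS subn0 mul1n.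
under eq_bigr => j _ do rewrite /bump /= add1n subSS -addn1 mulnDl mul1n.
by rewrite big_split /= IHw sum_bin_rev [RHS]binS [in RHS](binS w s); lia.
Qed.

Variables K m : nat.
Hypothesis m_gt0 : 0 < m.

(** The solution of [nb_laminar_rec], by induction on the number of intervals
    and then on the number of exposed points. Here [w + 1] is the sum of the [k]
    over the maximal intervals, those of length [m k + 1] that lie in no other
    interval of the family. *)
Lemma nb_laminarE x y r w s : x <= y -> y < K -> y - x = r + m * w.+1 ->
  s.+1 * nb_laminar K m x y r s.+1 = r * 'C(w, s) * 'C(y - x + s, s).
Proof.
move=> xy yK; elim: s r w x xy => [|s IHs] r w x xy.
  elim: r x xy => [|r IHr] x xy hw.
    by rewrite nb_laminar_r0 ?muln0 //; lia.
  rewrite !bin0 !muln1 mul1n (@nb_laminar_rec _ _ _ _ _ _ w.+1 m_gt0) //;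
    try lia.
  have := IHr x.+1; rewrite !bin0 !muln1 mul1n => ->; try lia.
  under eq_bigr => j _.
    rewrite nb_laminar0 // hw eqn_add2l eqn_pmul2l // eqSS.
    over.
  rewrite (bigD1 ord_max) //= eqxx big1 ?addn0 ?addn1 // => j.
  by rewrite -val_eqE /= => /negbTE ->.
elim: r x xy => [|r IHr] x xy hw.
  by rewrite nb_laminar_r0 ?muln0 //; lia.
rewrite (@nb_laminar_rec _ _ _ _ _ _ w.+1 m_gt0) //; try lia.
rewrite mulnDr IHr //; try lia.
(* in the last term the number of exposed points leaves no room for intervals *)
rewrite big_ord_recr /= -hw nb_laminar_full // addn0.
have S : s.+1 * \sum_(j < w) nb_laminar K m x y (r.+1 + m * j.+1) s.+1 =
    (r.+1 * 'C(w, s.+1) + m * 'C(w.+1, s.+2)) * 'C(y - x + s, s).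
  rewrite big_distrr /= -sum_bin_rev -sum_bin_rev_weighted !big_distrr /=.
  rewrite -big_split /= big_distrl /=; apply: eq_bigr => j _.
  rewrite (IHs _ (w - j.+1)) //; last first.
    rewrite hw -addnA -mulnDr; congr (_ + _ * _).
    by have := ltn_ord j; lia.
  by rewrite mulnDl mulnA.
set A := y - x in S *.
have -> : y - x.+1 + s.+1 = A + s by rewrite /A; lia.
apply/eqP; rewrite -(eqn_pmul2l (ltn0Sn s)) mulnDr.
rewrite [s.+1 * (s.+2 * _)]mulnCA S.
have -> : 'C(A + s.+1, s.+1) = 'C(A + s, s.+1) + 'C(A + s, s).
  by rewrite addnS binS.
have h1 : s.+1 * 'C(A + s, s.+1) = A * 'C(A + s, s).
  by rewrite mul_bin_left addnK.
have h2 : s.+2 * 'C(w.+1, s.+2) = w.+1 * 'C(w, s.+1) by rewrite -mul_bin_diag.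
move: h1 h2 hw; move: 'C(A + s, s.+1) 'C(A + s, s) 'C(w.+1, s.+2) 'C(w, s.+1).
move=> a b c d h1 h2 hw; apply/eqP; move: hw; rewrite -/A => hw.
have -> : s.+1 * (r.+1 * d * (a + b)) =
          r.+1 * d * (s.+1 * a) + s.+1 * r.+1 * d * b by ring.
have -> : s.+1 * (r * d * a) = r * d * (s.+1 * a) by ring.
have -> : s.+2 * ((r.+1 * d + m * c) * b) =
          s.+2 * r.+1 * d * b + m * (s.+2 * c) * b by ring.
by rewrite h1 h2 hw; ring.
Qed.

End ClosedForm.

(** * From face numbers to the h-vector *)

Lemma cdim_fcount (T : finType) (K : {set {set T}}) (d : nat) :
  fcount K d != 0%N -> (forall k, (d < k)%N -> fcount K k = 0%N) -> cdim K = d.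
Proof.
move=> fd f0; apply/eqP; rewrite eqn_leq; apply/andP; split.
  apply/bigmax_leqP => F FK; rewrite leqNgt; apply/negP => /f0/eqP.
  by rewrite cards_eq0 => /eqP/setP/(_ F); rewrite !inE FK eqxx.
move: fd; rewrite -lt0n => /card_gt0P[F]; rewrite inE => /andP[FK /eqP <-].
by rewrite /cdim (bigD1 F) //= leq_maxl.
Qed.

(** Expanding ['X^(d - i) = (('X - 1) + 1)^(d - i)] turns the defining identity
    of the h-vector into a formula for the face numbers, which determine the
    h-vector. *)
Lemma hvector_fcount (T : finType) (K : {set {set T}}) (d : nat)
    (h : nat -> rat) :
  cdim K = d ->
  (forall k, (k <= d)%N ->
    (fcount K k)%:R = \sum_(i < k.+1) h i * 'C(d - i, d - k)%:R) ->
  forall i, (i <= d)%N -> ((hvector K)`_i)%:~R = h i.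
Proof.
move=> dK fE i le_id.
have hX : map_poly (intr : int -> rat) (hpoly K) =
    \sum_(i < d.+1) h i *: 'X^(d - i).
  rewrite /hpoly dK rmorph_sum /=.
  under eq_bigr => k _.
    rewrite map_polyZ rmorphXn /= rmorphB /= map_polyX rmorph1 rmorph_nat /=.
    rewrite fE; last by rewrite -ltnS.
    rewrite scaler_suml (big_ord_widen_cond d.+1 predT
      (fun i => (h i * 'C(d - i, d - k)%:R) *: ('X - 1) ^+ (d - k))) //.
    over.
  rewrite (exchange_big_dep predT) //=; apply: eq_bigr => j _.
  have jd : (j <= d)%N by rewrite -ltnS.
  under eq_bigr => k _ do rewrite -scalerA.
  rewrite -scaler_sumr; congr (_ *: _).
  rewrite -[in RHS](subrK 1 'X) exprD1n -(big_mkord predT (fun k =>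
    ('X - 1 : {poly rat}) ^+ k *+ 'C(d - j, k))).
  rewrite (big_nat_widen _ _ d.+1) /=; last by lia.
  rewrite big_mkord [RHS](reindex_inj rev_ord_inj) /=.
  apply: eq_big => [k | k _]; first by rewrite subSS; have := ltn_ord k; lia.
  by rewrite subSS scaler_nat.
have -> : (hvector K)`_i = (hpoly K)`_(d - i) by rewrite nth_mkseq dK.
rewrite -coef_map /= hX coef_sum (bigD1 (Ordinal (le_id : (i < d.+1)%N))) //=.
rewrite coefZ coefXn eqxx mulr1 big1 ?addr0 // => j.
rewrite -val_eqE /= coefZ coefXn => ji; have jd := ltn_ord j.
by rewrite (_ : (_ == _) = false) ?mulr0 //; apply/negbTE; lia.
Qed.

Lemma bin_trinomial (n k i : nat) : (i <= k)%N -> (k <= n)%N ->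
  ('C(n, i) * 'C(n - i, n - k) = 'C(n, k) * 'C(k, i))%N.
Proof.
move=> ik kn.
have -> : (n - k = (n - i) - (k - i))%N by lia.
rewrite bin_sub; last by lia.
have fpos : (0 < i`! * (k - i)`! * (n - k)`!)%N by rewrite !muln_gt0 !fact_gt0.
have h1 := bin_fact (leq_trans ik kn).
have h2 := bin_fact kn; have h3 := bin_fact ik.
have /bin_fact h4 : (k - i <= n - i)%N by lia.
apply/eqP; rewrite -(eqn_pmul2r fpos).
have e4 : (n - i - (k - i) = n - k)%N by lia.
rewrite e4 in h4.
have -> : ('C(n, i) * 'C(n - i, k - i) * (i`! * (k - i)`! * (n - k)`!) =
  'C(n, i) * (i`! * ('C(n - i, k - i) * ((k - i)`! * (n - k)`!))))%N by ring.
have -> : ('C(n, k) * 'C(k, i) * (i`! * (k - i)`! * (n - k)`!) =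
  'C(n, k) * ('C(k, i) * (i`! * (k - i)`!) * (n - k)`!))%N by ring.
by rewrite h3 h4 h1 h2.
Qed.

Lemma Vandermonde_rev (k l : nat) :
  (\sum_(i < k.+1) 'C(k, i) * 'C(l, i) = 'C(l + k, k))%N.
Proof.
rewrite addnC -(binomial.Vandermonde k l k) (reindex_inj rev_ord_inj) /=.
apply: eq_bigr => i _; have ik : (i <= k)%N by rewrite -ltnS.
by rewrite subSS bin_sub.
Qed.

(** After [bin_trinomial] extracts ['C(n, k)], this is the Vandermonde
    convolution. The same holds for [h_to_f_A], where the factor [1 / (i + 1)]
    is absorbed by [(i + 1) 'C(k + 1, i + 1) = (k + 1) 'C(k, i)]. *)
Lemma h_to_f_B (n N k : nat) : (k <= n)%N ->
  (\sum_(i < k.+1) 'C(n, i) * 'C(N, i) * 'C(n - i, n - k) =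
   'C(n, k) * 'C(N + k, k))%N.
Proof.
move=> kn; rewrite -Vandermonde_rev big_distrr /=; apply: eq_bigr => i _.
have ik : (i <= k)%N by rewrite -ltnS.
by rewrite mulnAC bin_trinomial // mulnA.
Qed.

Lemma h_to_f_A (d N k : nat) : (k <= d)%N ->
  \sum_(i < k.+1) (i.+1%:R^-1 * 'C(d, i)%:R * 'C(N, i)%:R) * 'C(d - i, d - k)%:R
  = k.+1%:R^-1 * ('C(d, k) * 'C(N + k.+1, k))%N%:R :> rat.
Proof.
move=> kd.
have V : (\sum_(i < k.+1) 'C(k.+1, i.+1) * 'C(N, i) = 'C(N + k.+1, k))%N.
  rewrite addnC -(binomial.Vandermonde k.+1 N k) (reindex_inj rev_ord_inj) /=.
  apply: eq_bigr => i _; have ik : (i <= k)%N by rewrite -ltnS.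
  by rewrite subSS -subSn // bin_sub //; lia.
rewrite -V big_distrr /= natr_sum mulr_sumr; apply: eq_bigr => i _.
have ik : (i <= k)%N by rewrite -ltnS.
have h : (i.+1%:R * 'C(k.+1, i.+1)%:R = k.+1%:R * 'C(k, i)%:R :> rat).
  by rewrite -!natrM mul_bin_diag.
have i0 : i.+1%:R != 0 :> rat by rewrite pnatr_eq0.
have k0 : k.+1%:R != 0 :> rat by rewrite pnatr_eq0.
have T := bin_trinomial ik kd.
rewrite !natrM.
have -> : 'C(k.+1, i.+1)%:R = k.+1%:R * 'C(k, i)%:R / i.+1%:R :> rat.
  by rewrite -h mulrC mulKf.
have T' : 'C(d, i)%:R * 'C(d - i, d - k)%:R = 'C(d, k)%:R * 'C(k, i)%:R :> rat.
  by rewrite -!natrM T.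
rewrite -[LHS]mulrA [_ * 'C(d - i, d - k)%:R]mulrC.
have -> : i.+1%:R^-1 * 'C(d, i)%:R * ('C(d - i, d - k)%:R * 'C(N, i)%:R) =
  i.+1%:R^-1 * ('C(d, i)%:R * 'C(d - i, d - k)%:R) * 'C(N, i)%:R :> rat by ring.
by rewrite T'; field; rewrite !nat1r i0 k0.
Qed.

(** * Type A *)

Section TypeA.

Variables (m n : nat).
Hypotheses (hm : (0 < m)%N) (hn : (0 < n)%N).

Lemma A_vertexP (d : {set 'I_(m * n).+2}) :
  reflect (exists a b k : nat, [/\ (b < (m * n).+2)%N, b = (a + (m * k).+1)%N,
             (0 < k < n)%N & d = [set a%:R; b%:R]])
          (A_vertex d).
Proof.
apply: (iffP andP).
  case=> _ /existsP[a /existsP[b /existsP[k /and4P[/eqP -> k0]]]].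
  have := ltn_ord a; have := ltn_ord b; have := ltn_ord k => kn bN aN.
  rewrite !card_arc_ord; case: (ltngtP a b) => ab /eqP ha /eqP hb.
  - exists a, b, k; split; rewrite ?natr_ordK //; lia.
  - exists b, a, (n - k)%N; split; rewrite ?natr_ordK 1?setUC //; last lia.
    rewrite mulnBr; rewrite mulnBr in hb; lia.
  - by move: hb; rewrite ab; nia.
case=> a [b [k [bN bE kn ->]]].
have mk : (m * k < m * n)%N by rewrite ltn_pmul2l //; lia.
have mk0 : (0 < m * k)%N by rewrite muln_gt0 hm; lia.
have aN : (a < (m * n).+2)%N by lia.
split.
  apply/existsP; exists a%:R; apply/existsP; exists b%:R; rewrite eqxx andbT.
  by rewrite -[a%:R]add0r -[b%:R]add0r nonconsecutive_nat; lia.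
have kn' : (k < n)%N by lia.
apply/existsP; exists a%:R; apply/existsP; exists b%:R; apply/existsP.
exists (Ordinal kn'); rewrite eqxx !card_arc_ord !natr_ord_val //= mulnBr.
have -> : (a <= b)%N by lia.
have -> : (b <= a)%N = false by lia.
by apply/and3P; split; lia.
Qed.

Variables (R : realType) (p : 'I_(m * n).+2 -> 'rV[R]_2).
Hypothesis convp : convex_polygon p.

(** Numbering the vertices from [0] to [L = m n + 1] makes the diagonals of the
    complex the admissible intervals of the window [[0, L]] other than the
    window itself, which is a side of the polygon. Adding this full interval to
    a face gives exactly the laminar families in which [0] is the only exposed
    point of [[0, L)]. *)
Lemma fcount_Delta_A k :
  (k.+1 * fcount (Delta_A p) k = 'C(n.-1, k) * 'C(m * n + k.+1, k))%N.
Proof.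
set L := (m * n).+1.
pose T := ('I_L.+1 * 'I_L.+1)%type.
pose full : T := (ord0, ord_max).
pose VS (e : T) := admissible m 0 L e && (e != full).
pose phi (e : T) := [set e.1; e.2].
have phiE e : phi e = [set (0 : 'I_(m * n).+2) + (e.1 : nat)%:R;
                           (0 : 'I_(m * n).+2) + (e.2 : nat)%:R].
  by rewrite !add0r !natr_ordK.
have VSlt (e : T) : VS e -> (e.1 < e.2)%N by case/andP => /and4P[]; lia.
have -> : fcount (Delta_A p) k =
   #|[set F in noncrossing_complex VS (@interval_cross _)
      | (#|F| == k) && true]|.
  rewrite (card_noncrossing_iso (VT := @A_vertex m n) (cT := cross p)
    (phi := phi) (Q := predT)) //.
  - by apply: eq_card => F; rewrite !inE andbT.
  - move=> [[a aN] [b bN]] /andP[/and4P[/= _ _ ab /dvdnP[j jE]] nf].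
    apply/A_vertexP; exists a, b, j; split=> //; [by lia | |]; last first.
      by rewrite /phi /= -[Ordinal aN]natr_ordK -[Ordinal bN]natr_ordK.
    apply/andP; split; first by case: j jE => //; lia.
    rewrite ltnNge; apply/negP => nj; case/eqP: nf.
    have mnj : (m * n <= m * j)%N by rewrite leq_mul.
    have bL := bN; rewrite {1}/L in bL.
    by congr (_, _); apply: val_inj => /=; lia.
  - move=> d /A_vertexP[a [b [j [bN bE jn ->]]]].
    have mk : (m * j < m * n)%N by rewrite ltn_pmul2l //; lia.
    have mk0 : (0 < m * j)%N by rewrite muln_gt0 hm; lia.
    exists (a%:R, b%:R); last by [].
    rewrite /VS /admissible /= !natr_ord_val; try lia.
    apply/andP; split.
      by apply/and3P; split; rewrite ?bE ?addKn ?dvdn_mulr //=; lia.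
    apply/eqP => -[/(congr1 val) /= aE /(congr1 val) /= bE'].
    by rewrite !natr_ord_val in aE bE'; lia.
  - move=> e f /VSlt e12 /VSlt f12 /set2_eq[[e1 e2] | [e1 e2]].
      by rewrite [e]surjective_pairing e1 e2 -surjective_pairing.
    by move: e12; rewrite e1 e2 ltnNge (ltnW f12).
  - by move=> e f /VSlt e12 /VSlt f12 ef; rewrite !phiE cross_interleaved.
have -> : #|[set F in noncrossing_complex VS (@interval_cross _)
             | (#|F| == k) && true]| = nb_laminar L.+1 m 0 L 1 k.+1.
  rewrite (_ : nb_laminar L.+1 m 0 L 1 k.+1 =
    #|[set F in laminar L.+1 m 0 L | [&& #|F| == k.+1, nb_exposed F 0 L == 1%N &
                             [exists e in F, e.1 == 0%N :> nat]]]|); last first.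
    apply: eq_card => F; rewrite [LHS]inE [RHS]inE.
    case: (boolP (F \in laminar _ _ _ _)) => //= lamF; rewrite andbCA.
    rewrite [RHS]andbCA; case: (nb_exposed _ _ _ =P _) => //= n1.
    have [lamF1 | [[a b] eF e1]] := laminar_split lamF.
      have [_ nE] := laminar_succ lamF1; move: n1; rewrite nE.
      by rewrite (@nb_exposed_ltn _ _ 1) ?(exposed_left lamF1) // /L; nia.
    by rewrite (_ : [exists e in F, _]) //; apply/exists_inP; exists (a, b);
      rewrite ?e1.
  rewrite card_remove_longest //; last first.
    by rewrite subn0 /L -addn1 mulnC modnMDl.
  apply: eq_card => F; rewrite [LHS]inE [RHS]inE andbT [RHS]andbCA andbC.
  congr (_ && _); apply/noncrossingP/andP.
    case=> FV Fc; have lamF : F \in laminar L.+1 m 0 L.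
      by apply/noncrossingP; split=> // e /FV /andP[].
    split=> //; have e0 := exposed_left lamF; have eL := exposed_right lamF.
    have [z [z0 zL ez n1 hz]] := next_exposed lamF e0 eL (ltn0Sn _).
    rewrite (@nb_exposed_cat _ _ _ z) ?(ltnW z0) // n1 nb_exposed_ltn ?ez //.
    rewrite ltn_neqAle zL andbT; apply/eqP => zE.
    case: hz => [|[f /FV /andP[_ nf] [f1 f2]]]; first by rewrite zE /L; nia.
    by case/eqP: nf; apply: interval_eq; rewrite ?f1 ?f2.
  case=> lamF nF; have /noncrossingP[Fa Fc] := lamF.
  split=> // e eF; rewrite /VS Fa //=; apply: contraTneq nF => eE.
  rewrite nb_exposed_hidden ?(exposed_left lamF) // => v v0 vL.
  by apply/negP => /exposedP/(_ e eF); rewrite eE; apply.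
have := @nb_laminarE L.+1 m hm 0 L 1 n.-1 k.
rewrite subn0 prednK // mul1n /L => -> //.
by congr (_ * 'C(_, _))%N; lia.
Qed.

End TypeA.

(** * Type B *)

Section TypeB.

Variables (m n : nat).
Hypotheses (hm : (0 < m)%N) (hn : (0 < n)%N).

(** Half of the number of vertices. *)
Let M := (m * n).+1.
Local Notation vertex := 'I_(2 * m * n).+2.
Implicit Types (v w : vertex) (a b c d u k : nat).

Lemma double_half : (2 * m * n).+2 = (M + M)%N.
Proof. by rewrite /M -mulnA; lia. Qed.

Lemma natr_half2 : (M + M)%:R = 0 :> vertex.
Proof. by rewrite -double_half natr_ordN. Qed.

Lemma barE v : bar v = v + M%:R.
Proof.
rewrite /bar; congr (_ + _); apply: val_inj.
have lt : (M < (2 * m * n).+2)%N by rewrite double_half /M; lia.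
by rewrite /= inordK // natr_ord_val.
Qed.

Definition chord v a b : {set vertex} := [set v + a%:R; v + b%:R].

(** The orbit of the diagonal [chord v a b] under the half-turn; it is a single
    diameter when [b = a + M]. *)
Definition bdiag v a b : {set {set vertex}} :=
  [set chord v a b; chord v (a + M) (b + M)].

Lemma chord_wrap v a b : chord v a (b + (M + M)) = chord v b a.
Proof. by rewrite /chord natrD natr_half2 addr0 setUC. Qed.

Lemma chordD v c a b : chord (v + c%:R) a b = chord v (c + a) (c + b).
Proof. by rewrite /chord !natrD !addrA. Qed.

Lemma bdiagD v c a b : bdiag (v + c%:R) a b = bdiag v (c + a) (c + b).
Proof. by rewrite /bdiag !chordD !addnA. Qed.

Lemma bdiag_half v a b : bdiag v (a + M) (b + M) = bdiag v a b.
Proof.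
have wrap c : v + (c + M + M)%:R = v + c%:R.
  by rewrite -addnA natrD natr_half2 addr0.
by rewrite /bdiag setUC; congr [set _; _]; rewrite /chord !wrap.
Qed.

Lemma bdiag_bar v a b :
  [set [set v + a%:R; v + b%:R]; [set bar (v + a%:R); bar (v + b%:R)]] =
  bdiag v a b.
Proof. by rewrite !barE -!addrA -!natrD. Qed.

Lemma diameterE v u : bdiag v u (u + M) = [set chord v u (u + M)].
Proof.
by rewrite /bdiag -addnA chord_wrap setUid.
Qed.

Lemma chord_inj v a b c d : (a < b < M + M)%N -> (c < d < M + M)%N ->
  chord v a b = chord v c d -> a = c /\ b = d.
Proof.
move=> ab cd; have inj x y : (x < M + M)%N -> (y < M + M)%N ->
    v + x%:R = v + y%:R -> x = y.
  by move=> hx hy /addrI/eqP; rewrite natr_ord_eq ?double_half // => /eqP.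
by case/set2_eq=> -[/inj h1 /inj h2]; lia.
Qed.

Lemma vertex_shift v w : exists2 c, (c < M + M)%N & w = v + c%:R.
Proof.
exists (w - v : vertex) => //; first by rewrite -double_half.
by rewrite natr_ordK addrC subrK.
Qed.

Lemma bdiag_inj v a b c d : (a < b <= M)%N -> (c < d <= M)%N ->
  bdiag v a b = bdiag v c d -> a = c /\ b = d.
Proof.
move=> ab cd E; have : chord v a b \in bdiag v c d by rewrite -E set21.
rewrite in_set2 => /orP[/eqP/chord_inj h | /eqP].
  by apply: h; rewrite /M in ab cd *; lia.
have [dM | dM] := ltnP d M.
  by move/chord_inj; rewrite /M in ab cd dM *; lia.
have -> : d = M by lia.
have := chord_wrap v (c + M) 0; rewrite add0n => ->.
by move/chord_inj; rewrite /M in ab cd dM *; lia.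
Qed.

Variables (R : realType) (p : vertex -> 'rV[R]_2).
Hypothesis convp : convex_polygon p.

Lemma cross_chord v a b c d : (a < b < M + M)%N -> (c < d < M + M)%N ->
  (a, b) != (c, d) ->
  cross p (chord v a b) (chord v c d) = interleaved (a, b) (c, d).
Proof.
move=> /andP[ab bM] /andP[cd dM] ne.
by apply: cross_interleaved => //; rewrite double_half.
Qed.

Lemma B_cross_set2 (x y z t : {set vertex}) :
  B_cross p [set x; y] [set z; t] =
  [|| cross p x z, cross p x t, cross p y z | cross p y t].
Proof.
apply/exists_inP/idP => [[e] | ].
  by rewrite !inE => /orP[] /eqP -> /exists_inP[f];
    rewrite !inE => /orP[] /eqP -> ->; rewrite ?orbT.
case/or4P => h.
- by exists x; rewrite ?set21 //; apply/exists_inP; exists z; rewrite ?set21.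
- by exists x; rewrite ?set21 //; apply/exists_inP; exists t; rewrite ?set22.
- by exists y; rewrite ?set22 //; apply/exists_inP; exists z; rewrite ?set21.
- by exists y; rewrite ?set22 //; apply/exists_inP; exists t; rewrite ?set22.
Qed.

(** The two chords are separated by the diameter at [v]. *)
Lemma cross_far v a b c d : (a < b <= M)%N -> (c < d <= M)%N ->
  (a, b) != (c, d) -> cross p (chord v a b) (chord v (c + M) (d + M)) = false.
Proof.
move=> ab cd ne; have [dM | dM] := ltnP d M.
  by rewrite cross_chord ?xpair_eqE /interleaved /=; rewrite /M in ab cd dM *;
    lia.
have dE : d = M by lia.
have := chord_wrap v (c + M) 0; rewrite dE add0n => ->.
have ne' : (a, b) != (0%N, (c + M)%N).
  by apply: contra ne; rewrite !xpair_eqE dE => /andP[/eqP -> /eqP]; lia.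
by rewrite cross_chord // /interleaved /=; rewrite /M in ab cd dM *; lia.
Qed.

Lemma B_cross_bdiag v a b c d : (a < b <= M)%N -> (c < d <= M)%N ->
  (a, b) != (c, d) ->
  B_cross p (bdiag v a b) (bdiag v c d) = interleaved (a, b) (c, d).
Proof.
move=> ab cd ne; rewrite B_cross_set2 cross_far //.
rewrite [cross p (chord _ (_ + _) _) _]cross_sym cross_far //; last first.
  by rewrite eq_sym.
rewrite ![(_ + M)%N]addnC -!chordD !cross_chord ?orbb //=;
  rewrite /M in ab cd *; lia.
Qed.

(** The equality is there because a diagonal crosses itself in the sense of
    [cross]. *)
Definition compatible (delta D : {set {set vertex}}) : bool :=
  (delta == D) || ~~ B_cross p delta D.

(** In the half-turn window of a base vertex [v], the diameters that do not
    cross a B-diagonal are those that start at a point it leaves exposed. *)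
Lemma diameter_compatible v u a b : (u < M)%N -> (a < b <= M)%N ->
  compatible (bdiag v u (u + M)) (bdiag v a b) = ~~ (a < u < b)%N.
Proof.
move=> uM ab; rewrite /compatible.
have [/eqP | ne] /= := boolP (_ == _).
  move=> E; have : chord v a b \in bdiag v u (u + M) by rewrite E set21.
  rewrite diameterE inE => /eqP/chord_inj [||-> _]; rewrite /M in uM ab *; lia.
have ne' : ~~ [&& u == 0, a == 0 & b == M]%N.
  by apply: contra ne => /and3P[/eqP -> /eqP -> /eqP ->].
rewrite [X in B_cross p X _]/bdiag -addnA chord_wrap B_cross_set2.
have [bM | bM] := ltnP b M.
  rewrite !cross_chord ?xpair_eqE /interleaved /=;
    rewrite /M in uM ab bM ne' *; lia.
have bE : b = M by lia.
have := chord_wrap v (a + M) 0; rewrite bE add0n => ->.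
rewrite !cross_chord ?xpair_eqE /interleaved /=;
  rewrite /M in bE uM ab bM ne' *; lia.
Qed.

Lemma B_vertexP D :
  reflect (exists v k, (0 < k <= n)%N /\ D = bdiag v 0 (m * k).+1)
          (B_vertex p D).
Proof.
apply: (iffP andP).
  case=> _ /existsP[a /existsP[b /existsP[k /and5P[/eqP -> k0 /eqP ha _ _]]]].
  have kn : (0 < k <= n)%N by have := ltn_ord k; lia.
  exists a, k; split=> //; have [c cM bE] := vertex_shift a b.
  suff -> : (m * k).+1 = c by rewrite -bdiag_bar -bE addr0.
  move: ha; have := @card_arc _ a 0 c (leq0n _); rewrite addr0 -bE subn0.
  rewrite add0n -[X in (_ < X)%N]/(2 * m * n).+2 {1}double_half => -> //.
  by lia.
case=> v [k [kn ->]]; set l := (m * k).+1.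
have mk : (m <= m * k <= m * n)%N by rewrite leq_pmulr ?leq_mul //; lia.
have lM : (1 < l <= M)%N by rewrite /l /M; lia.
have bE := bdiag_bar v 0 l; rewrite addr0 in bE.
split.
  have [kE | nk] := eqVneq k n.
    apply/orP; left; apply/existsP; exists v; apply/eqP.
    have -> : l = (0 + M)%N by rewrite /l /M kE.
    by rewrite diameterE /chord addr0 barE.
  have lM' : (l < M)%N by rewrite /l /M ltnS ltn_pmul2l //; lia.
  apply/orP; right; apply/existsP; exists v; apply/existsP.
  exists (v + l%:R); rewrite bE eqxx andbT; apply/andP; split.
    have := @nonconsecutive_nat _ v 0 l; rewrite addr0; apply; first by lia.
      by rewrite double_half; lia.
    by rewrite add0n -ltnS double_half; lia.
  rewrite !barE -addrA -natrD.
  have := @cross_chord v 0 l M (l + M); rewrite /chord addr0 => ->; try lia.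
    by rewrite /interleaved /=; lia.
  by rewrite xpair_eqE; lia.
have kn' : (k < n.+1)%N by lia.
apply/existsP; exists v; apply/existsP; exists (v + l%:R); apply/existsP.
exists (Ordinal kn'); rewrite bE eqxx /=; apply/and4P; split; first by lia.
- have := @card_arc _ v 0 l (leq0n _); rewrite addr0 => ->;
  first by rewrite /l; lia.
  by rewrite double_half; lia.
- rewrite !barE -addrA -natrD (@card_arc _ v M (l + M)) ?double_half;
  rewrite /l; lia.
(* seen from [w], both arcs of the central polygon are free of wrap-around *)
set w := v + l%:R.
have E0 : v = w + (M + M - l)%:R.
  by rewrite -addrA -natrD subnKC ?natr_half2 ?addr0 //; lia.
have E1 : bar v = w + (M - l)%:R by rewrite barE -addrA -natrD subnKC //; lia.
rewrite E1 [bar w]barE [X in Defs.arc (w + _) X]E0.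
have -> : Defs.arc w (w + (M - l)%:R) = Defs.arc (w + 0%:R) (w + (M - l)%:R).
  by rewrite addr0.
rewrite cardsU (@card_arc _ w 0) ?(@card_arc _ w M) ?double_half; try lia.
rewrite (_ : _ :&: _ = set0) ?cards0.
  have -> : (2 * m * (n - k) = m * n - m * k + (m * n - m * k))%N.
    by rewrite -mulnA mulnBr; lia.
  by rewrite /l /M; lia.
apply/setP => x; have [c cM ->] := vertex_shift w x.
by rewrite in_setI !mem_arc ?double_half ?inE; lia.
Qed.

(** Of the two chords of a B-diagonal, one has its first endpoint in the half of
    the polygon that starts at [v]. *)
Lemma B_repr v D : B_vertex p D -> exists a k,
  [/\ (a < M)%N, (0 < k <= n)%N & D = bdiag v a (a + (m * k).+1)].
Proof.
case/B_vertexP=> w [k [kn ->]]; have [c cM ->] := vertex_shift v w.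
have [cM' | Mc] := ltnP c M.
  by exists c, k; rewrite bdiagD addn0.
exists (c - M)%N, k; split=> //; first by lia.
by rewrite bdiagD addn0 -[RHS]bdiag_half; congr bdiag; lia.
Qed.

Lemma B_vertex_bdiag v a k : (0 < k <= n)%N ->
  B_vertex p (bdiag v a (a + (m * k).+1)).
Proof.
by move=> kn; apply/B_vertexP; exists (v + a%:R), k; rewrite bdiagD addn0.
Qed.

Lemma size_le_half k : (k <= n)%N -> ((m * k).+1 <= M)%N.
Proof. by move=> kn; rewrite /M ltnS leq_mul. Qed.

(** The chord provided by [B_repr] can only leave the half of the polygon in
    which it starts by crossing the diameter at [v]. *)
Lemma compatible_window v D : B_vertex p D -> compatible (bdiag v 0 M) D ->
  exists a k, [/\ (0 < k <= n)%N, (a + (m * k).+1 <= M)%N &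
                  D = bdiag v a (a + (m * k).+1)].
Proof.
move=> /(B_repr v)[a [k [aM kn ->]]] cp; exists a, k; split=> //.
have kl : ((m * k).+1 <= M)%N by apply: size_le_half; lia.
move: (m * k).+1 kl cp (ltn0Sn (m * k)) => l lM cp l0; rewrite leqNgt;
  apply/negP => Mb.
case/orP: cp => [/eqP E | ].
  have : chord v a (a + l) \in bdiag v 0 (0 + M) by rewrite add0n E set21.
  by rewrite diameterE inE => /eqP/chord_inj; lia.
rewrite B_cross_set2 cross_chord ?xpair_eqE ?negb_or; try lia.
by rewrite /interleaved /=; lia.
Qed.

Definition all_compatible (delta : {set {set vertex}})
    (F : {set {set {set vertex}}}) : bool :=
  [forall D in F, compatible delta D].

Definition diameters : {set {set {set vertex}}} :=
  [set bdiag v 0 M | v : vertex].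

(** The number of exposed points ([nb_diameters_interval_bdiag]), in a form that
    does not depend on the choice of a base vertex. *)
Definition nb_diameters (F : {set {set {set vertex}}}) : nat :=
  \sum_(delta in diameters) all_compatible delta F.

Lemma diametersE v : diameters = [set bdiag v u (u + M) | u : 'I_M].
Proof.
apply/setP => D; apply/imsetP/imsetP => [[w _ ->] | [u _ ->]]; last first.
  by exists (v + (u : nat)%:R) => //; rewrite bdiagD addn0.
have [c cM ->] := vertex_shift v w; rewrite bdiagD addn0.
have [cM' | Mc] := ltnP c M; first by exists (Ordinal cM').
have cM' : (c - M < M)%N by lia.
exists (Ordinal cM') => //=; rewrite -[RHS]bdiag_half; congr bdiag; lia.
Qed.

Lemma diameter_inj v : injective (fun u : 'I_M => bdiag v u (u + M)).
Proof.
move=> u u'; rewrite !diameterE => /set1_inj/chord_inj E.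
have uM := ltn_ord u; have uM' := ltn_ord u'; have M0 : (0 < M)%N by [].
by case: E => [| |h _]; [lia | lia | apply: val_inj].
Qed.

Lemma card_diameters : #|diameters| = M.
Proof.
by rewrite (diametersE 0) card_imset ?card_ord //; apply: diameter_inj.
Qed.

Local Notation interval := (vertex * vertex)%type.

Definition interval_bdiag v (e : interval) : {set {set vertex}} :=
  bdiag v e.1 e.2.

Lemma interval_bdiag_compatible v u (e : interval) : (u < M)%N ->
  admissible m 0 M e ->
  compatible (bdiag v u (u + M)) (interval_bdiag v e) = ~~ (e.1 < u < e.2)%N.
Proof.
case: e => [[a aK] [b bK]] uM /and4P[/= _ bM ab _].
by rewrite /interval_bdiag /= diameter_compatible //; apply/andP; split=> //;
  apply: ltnW.
Qed.

Lemma nb_diameters_interval_bdiag v (F : {set interval}) :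
  (forall e, e \in F -> admissible m 0 M e) ->
  nb_diameters (interval_bdiag v @: F) = nb_exposed F 0 M.
Proof.
move=> adm; rewrite /nb_diameters (diametersE v) big_imset /=; last first.
  by move=> u u' _ _; apply: diameter_inj.
rewrite /nb_exposed big_mkord; apply: eq_bigr => u _; congr nat_of_bool.
have uM : (u < M)%N by [].
apply/forall_inP/forall_inP => h => [e eF | _ /imsetP[e eF ->]].
  by rewrite -(interval_bdiag_compatible v uM) ?adm // h ?imset_f.
by rewrite interval_bdiag_compatible ?adm // h.
Qed.

Lemma admissibleP (e : interval) : admissible m 0 M e ->
  exists a k, [/\ (0 < k <= n)%N, (a + (m * k).+1 <= M)%N, e.1 = a :> nat &
                  e.2 = (a + (m * k).+1)%N :> nat].
Proof.
case: e => [[a aK] [b bK]] /and4P[/= _ bM ab /dvdnP[j jE]].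
exists a, j; split=> //=; last by lia.
- apply/andP; split; first by case: j jE; lia.
  by rewrite -(leq_pmul2l hm); rewrite /M in bM; lia.
- by rewrite /M in bM *; lia.
Qed.

(** Cutting the polygon along the diameter at [v] turns the faces compatible
    with it into laminar families in a window of length [M], the diameter itself
    being the full interval. *)
Lemma card_all_compatible v s r :
  #|[set F in Delta_B p | [&& #|F| == s, all_compatible (bdiag v 0 M) F &
                              nb_diameters F == r]]| =
  nb_laminar (2 * m * n).+2 m 0 M r s.
Proof.
pose VT D := B_vertex p D && compatible (bdiag v 0 M) D.
have -> : [set F in Delta_B p | [&& #|F| == s, all_compatible (bdiag v 0 M) F &
                                   nb_diameters F == r]] =
    [set F in noncrossing_complex VT (B_cross p)
     | (#|F| == s) && (nb_diameters F == r)].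
  apply/setP => F; rewrite [LHS]inE [RHS]inE [X in _ && X]andbCA andbA.
  congr (_ && _); apply/andP/noncrossingP =>
    [[/noncrossingP[FV Fc] /forall_inP th] | ].
    by split=> // D DF; rewrite /VT FV ?th.
  case=> FV Fc; split.
    by apply/noncrossingP; split=> // D /FV /andP[].
  by apply/forall_inP => D /FV /andP[].
rewrite -(card_noncrossing_iso (VS := admissible m 0 M)
  (cS := @interval_cross _) (phi := interval_bdiag v)
  (P := fun F => nb_exposed F 0 M == r)) //.
- move=> e adm; have [a [k [kn aM e1 e2]]] := admissibleP adm.
  rewrite /VT -[X in compatible (bdiag _ _ X) _]add0n
    interval_bdiag_compatible //= andbT.
  by rewrite /interval_bdiag e1 e2 B_vertex_bdiag.
- move=> D /andP[DV Dc]; have [a [k [kn aM ->]]] := compatible_window DV Dc.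
  have aK : (a < (2 * m * n).+2)%N by rewrite double_half; lia.
  have bK : (a + (m * k).+1 < (2 * m * n).+2)%N by rewrite double_half; lia.
  exists (Ordinal aK, Ordinal bK); rewrite // /admissible /= aM addKn /=.
  have mk0 : (0 < m * k)%N by rewrite muln_gt0 hm; lia.
  by rewrite dvdn_mulr // andbT; lia.
- move=> e f /admissibleP[a [k [_ aM e1 e2]]] /admissibleP[b [j [_ bM f1 f2]]].
  rewrite /interval_bdiag e1 e2 f1 f2 => /bdiag_inj E.
  have [||ab kj] := E; [lia | lia |].
  by apply: interval_eq; rewrite ?e1 ?f1 // e2 f2.
- move=> e f /admissibleP[a [k [_ aM e1 e2]]] /admissibleP[b [j [_ bM f1 f2]]].
  move=> ef; rewrite /interval_bdiag B_cross_bdiag ?e1 ?e2 ?f1 ?f2; [|lia|lia|].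
    by rewrite /interval_cross e1 e2 f1 f2.
  apply: contra ef => /eqP[ab kj].
  by apply/eqP/interval_eq; rewrite ?e1 ?f1 // e2 f2.
- by move=> F /noncrossingP[adm _]; rewrite nb_diameters_interval_bdiag.
Qed.

(** Double counting of the pairs of a face and a diameter compatible with it: a
    face counted on the left has [r] such diameters, and each of the [M]
    diameters contributes the same number by [card_all_compatible]. *)
Lemma card_nb_diameters s r :
  (r * #|[set F in Delta_B p | (#|F| == s) && (nb_diameters F == r)]| =
   M * nb_laminar (2 * m * n).+2 m 0 M r s)%N.
Proof.
set A := [set F in _ | _].
rewrite mulnC -sum_nat_const.
have -> : (\sum_(F in A) r = \sum_(F in A) nb_diameters F)%N.
  by apply: eq_bigr => F; rewrite inE => /and3P[_ _ /eqP].
rewrite /nb_diameters exchange_big /=.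
rewrite -[X in (X * nb_laminar _ _ _ _ _ _)%N]card_diameters -sum_nat_const.
apply: eq_bigr => _ /imsetP[v _ ->]; rewrite -(card_all_compatible v).
rewrite -sum1_card big_mkcond [RHS]big_mkcond /=; apply: eq_bigr => F _.
rewrite [in LHS]inE [in RHS]inE.
by case: (F \in _); case: (#|F| == s); case: (nb_diameters F == r);
  case: (all_compatible _ F).
Qed.

(** The diameter at the start of a longest B-diagonal of [F] works: an element
    of [F] that crosses this diameter, but neither chord of the longest
    B-diagonal, would be longer. *)
Lemma nb_diameters_gt0 F : F \in Delta_B p -> (0 < nb_diameters F)%N.
Proof.
move=> /noncrossingP[FV Fc].
suff [v th] : exists v, all_compatible (bdiag v 0 M) F.
  have dv : bdiag v 0 M \in diameters by apply: imset_f.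
  by rewrite /nb_diameters (bigD1 _ dv) /= th.
(* [P k]: some B-diagonal of [F] cuts off [(m k + 2)]-gons *)
pose P k := (k <= n)%N && [exists v, bdiag v 0 (m * k).+1 \in F].
have [-> | [D0 D0F]] := set_0Vmem F.
  by exists 0; apply/forall_inP => D; rewrite inE.
have exP : exists k, P k.
  have /B_vertexP[v [k [kn DE]]] := FV _ D0F; exists k; rewrite /P.
  by apply/andP; split; [lia | apply/existsP; exists v; rewrite -DE].
have ubP k : P k -> (k <= n)%N by case/andP.
case: (ex_maxnP exP ubP) => k0 /andP[k0n /existsP[v vF]] kmax.
exists v; apply/forall_inP => D DF.
have [a [k [aM kn DE]]] := B_repr v (FV _ DF).
have kk0 : (k <= k0)%N.
  apply: kmax; apply/andP; split; first by lia.
  by apply/existsP; exists (v + a%:R); rewrite bdiagD addn0 -DE.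
have kl : ((m * k).+1 <= (m * k0).+1 <= M)%N.
  by rewrite size_le_half // andbT ltnS leq_mul.
move: (m * k0).+1 (m * k).+1 (ltn0Sn (m * k0)) (ltn0Sn (m * k)) kl vF DE.
move=> l0 l l0gt0 lgt0 /andP[ll0 l0M] vF DE; subst D.
have [alM | Mal] := leqP (a + l) M.
  by rewrite -[X in bdiag _ _ X]add0n diameter_compatible //; lia.
have aK : (a < a + l < M + M)%N by lia.
(* [chord v a (a + l)] crosses the second chord of the longest B-diagonal, which
   is its only one if it is a diameter *)
have [l0M' | Ml0] := ltnP l0 M.
  have ne : bdiag v a (a + l) != bdiag v 0 l0.
    apply/eqP => E.
    have : chord v a (a + l) \in bdiag v 0 l0 by rewrite -E set21.
    by rewrite in_set2 => /orP[] /eqP /chord_inj; lia.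
  have := Fc _ _ DF vF ne; rewrite B_cross_set2.
  rewrite [cross p _ (chord v (0 + M) _)]cross_chord //.
  - by rewrite /interleaved /=; lia.
  - by lia.
  - by rewrite xpair_eqE; lia.
have l0E : l0 = (0 + M)%N by lia.
have ne : bdiag v a (a + l) != bdiag v 0 l0.
  apply/eqP => E; have : chord v a (a + l) \in bdiag v 0 l0 by rewrite -E set21.
  by rewrite l0E diameterE inE => /eqP /chord_inj; lia.
have := Fc _ _ DF vF ne; rewrite B_cross_set2.
rewrite [cross p _ (chord v 0 l0)]cross_chord //.
- by rewrite /interleaved /=; lia.
- by lia.
- by rewrite xpair_eqE; lia.
Qed.

Lemma fcount_Delta_B0 : fcount (Delta_B p) 0 = 1%N.
Proof.
rewrite /fcount -[RHS](cards1 (set0 : {set {set {set vertex}}})).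
apply: eq_card => F; rewrite [LHS]inE [RHS]inE cards_eq0 andbC.
case: eqP => //= ->; apply/noncrossingP.
by split=> [D | D E]; rewrite inE.
Qed.

Lemma card_nb_diameters_weight s j : (j < n)%N ->
  #|[set F in Delta_B p | (#|F| == s.+1) &&
                          (nb_diameters F == M - m * j.+1)%N]| =
  ('C(j, s) * 'C(M + s, s.+1))%N.
Proof.
move=> jn; have mj : (m * j.+1 <= m * n)%N by rewrite leq_mul.
have r0 : (0 < M - m * j.+1)%N by rewrite /M; lia.
have := @nb_laminarE (2 * m * n).+2 m hm 0 M (M - m * j.+1) j s.
rewrite subn0 subnK; last by rewrite /M; lia.
have MK : (M < (2 * m * n).+2)%N by rewrite double_half /M; lia.
move=> /(_ (leq0n _) MK erefl) E.
have := card_nb_diameters s.+1 (M - m * j.+1).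
have h : (s.+1 * 'C(M + s, s.+1) = M * 'C(M + s, s))%N.
  by rewrite mul_bin_left addnK.
set c := #|_| => rc.
apply/eqP; rewrite -(eqn_pmul2l r0) -(eqn_pmul2l (ltn0Sn s)) rc; apply/eqP.
rewrite mulnCA E.
transitivity ((M - m * j.+1) * 'C(j, s) * (M * 'C(M + s, s)))%N; first by ring.
by rewrite -h; ring.
Qed.

Lemma nb_diameters_weight F : F \in Delta_B p -> F != set0 ->
  exists2 j, (j < n)%N & nb_diameters F = (M - m * j.+1)%N.
Proof.
move=> FK F0; have nd0 := nb_diameters_gt0 FK.
have := card_nb_diameters #|F| (nb_diameters F).
have [s Fs] : exists s, #|F| = s.+1.
  by exists #|F|.-1; rewrite prednK // card_gt0.
set A := [set G in _ | _] => AE.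
have FA : F \in A by rewrite inE FK !eqxx.
have lam0 : nb_laminar (2 * m * n).+2 m 0 M (nb_diameters F) s.+1 != 0%N.
  rewrite -Fs; apply: contraTneq FA => l0; move: AE; rewrite l0 muln0 => /eqP.
  by rewrite muln_eq0 eqn0Ngt nd0 /= cards_eq0 => /eqP ->; rewrite inE.
have MK : (M < (2 * m * n).+2)%N by rewrite double_half /M; lia.
have rmod : nb_diameters F = M - 0 %[mod m].
  by apply/eqP; apply: contraNT lam0 => ?; rewrite nb_laminar_mod.
have rM : nb_diameters F != M.
  apply: contra lam0 => /eqP ->.
  have := @nb_laminar_full (2 * m * n).+2 m 0 M s.
  by rewrite subn0 => ->.
have rle : (nb_diameters F <= M)%N.
  have : (0 < nb_laminar (2 * m * n).+2 m 0 M (nb_diameters F) s.+1)%N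
    by rewrite lt0n.
  case/card_gt0P=> G; rewrite inE => /and3P[_ _ /eqP <-].
  by rewrite -[X in (_ <= X)%N]subn0 nb_exposed_le.
move/eqP: rmod; rewrite subn0 eq_sym eqn_mod_dvd // => /dvdnP[[|j] jE];
  first by lia.
have jn : (m * j.+1 <= m * n)%N by rewrite /M in jE nd0 *; lia.
by exists j; [rewrite leq_pmul2l // in jn | rewrite mulnC; lia].
Qed.

(** Summing over the possible numbers [M - m (j + 1)] of compatible diameters
    with the hockey-stick identity [sum_bin_rev]. *)
Lemma fcount_Delta_B k :
  fcount (Delta_B p) k = ('C(n, k) * 'C(m * n + k, k))%N.
Proof.
case: k => [|s]; first by rewrite fcount_Delta_B0 !bin0.
have -> : (m * n + s.+1 = M + s)%N by rewrite /M; lia.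
rewrite -sum_bin_rev (reindex_inj rev_ord_inj) /= big_distrl /=.
rewrite /fcount -sum1_card.
(* [h F] is the [w] of [nb_laminarE]; the default value is never taken *)
pose h F : 'I_n := insubd (Ordinal hn) ((M - nb_diameters F) %/ m).-1.
rewrite (partition_big h predT) //=; apply: eq_bigr => j _.
have -> : (n - (n - j.+1).+1 = j)%N by have := ltn_ord j; lia.
rewrite -card_nb_diameters_weight // sum1_card; apply: eq_card => F.
rewrite unfold_in [RHS]inE inE -!andbA; apply: andb_id2l => FK.
apply: andb_id2l => /eqP Fs.
have F0 : F != set0 by apply/eqP => F0; rewrite F0 cards0 in Fs.
have [i ni nd] := nb_diameters_weight FK F0.
have mi : (m * i.+1 <= m * n)%N by rewrite leq_pmul2l.
have mj : (m * j.+1 <= m * n)%N by rewrite leq_pmul2l.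
have hE : h F = i :> nat.
  by rewrite /h nd subKn ?mulKn //= ?insubdK ?unfold_in //; rewrite /M; lia.
rewrite -val_eqE /= hE nd; apply/eqP/eqP => [-> // | E].
have /eqP : (m * i.+1 = m * j.+1)%N by rewrite /M in E; lia.
by rewrite eqn_pmul2l // eqSS => /eqP.
Qed.

End TypeB.

(** * The h-vectors *)

Theorem corollary1p3 (R : realType) (m n : nat)
    (hm : (1 <= m)%N) (hn : (1 <= n)%N) :
  (forall p : 'I_(m * n).+2 -> 'rV[R]_2,
     convex_polygon p ->
     forall i : nat, (i <= n - 1)%N ->
       ((hvector (Delta_A p))`_i)%:~R =
       (i.+1%:R)^-1 * ('C(n - 1, i))%:R * ('C(m * n, i))%:R :> rat)
  /\
  (forall p : 'I_(2 * m * n).+2 -> 'rV[R]_2,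
     convex_polygon p -> centrally_symmetric p ->
     forall i : nat, (i <= n)%N ->
       (hvector (Delta_B p))`_i = ('C(n, i) * 'C(m * n, i))%:Z).
Proof.
split=> [p convp | p convp _ i le_in].
  have fE := fcount_Delta_A hm hn convp; rewrite -subn1 in fE.
  apply: hvector_fcount => [|k kn].
    apply: cdim_fcount => [|k kn]; apply/eqP.
      move=> f0; have := fE (n - 1)%N; rewrite f0 muln0 binn mul1n => /esym/eqP.
      by rewrite -leqn0 leqNgt bin_gt0; lia.
    by have /eqP := fE k; rewrite bin_small // mul0n muln_eq0.
  by rewrite h_to_f_A // -fE natrM mulKf // pnatr_eq0.
have fE := fcount_Delta_B hm hn convp.
have hE : ((hvector (Delta_B p))`_i)%:~R =
          ('C(n, i) * 'C(m * n, i))%N%:~R :> rat.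
  apply: (hvector_fcount (h := fun i => ('C(n, i) * 'C(m * n, i))%N%:R)) le_in.
    apply: cdim_fcount => [|k kn]; last by rewrite fE bin_small.
    by rewrite fE binn mul1n -lt0n bin_gt0; lia.
  move=> k kn; rewrite fE -h_to_f_B // natr_sum.
  by apply: eq_bigr => j _; rewrite natrM.
by apply: intr_inj hE.
Qed.
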